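(* Let $\Omega=A\cup B$, $J$, $G$ be as in the context. Let $v_0\in L^2(B)$ and let $(u,v)$ be the solution of the elliptic--parabolic coupled system described in the context with initial datum $v_0$. Then $v(\cdot,t)$ converges exponentially to its mean value as $t\to\infty$. More precisely, there exists a constant $\lambda_1>0$ such that $$\|v(\cdot,t)-\overline{v_0}\|_{L^2(B)}\le e^{-\lambda_1t}\|v_0\|_{L^2(B)},\qquad t>0,\qquad\text{where }\ \overline{v_0}:=\frac1{|B|}\int_Bv_0(x)\,dx .$$
   Context: Setting: $\Omega\subset\mathbb{R}^N$ is a bounded smooth domain partitioned as $\Omega=A\cup B$, where $A,B$ are disjoint nonempty connected subdomains (open sets; the equality is understood up to the interface, which has measure zero), $A$ has smooth boundary, and $\eta$ is the outward unit normal to $\partial A$. Each kernel $K=J,G\in C(\mathbb{R}^N,\mathbb{R})$ is nonnegative, continuous and radial, with $K(0)>0$, $\int_{\mathbb{R}^N}K(z)\,dz=1$, and there exist $x\in A$, $y\in B$ with $x-y\in\operatorname{supp}K$. System: $0=\Delta u+\int_BJ(x-y)(v(y,t)-u(x,t))\,dy$ in $A\times(0,\infty)$, $\partial u/\partial\eta=0$ on $\partial A\times(0,\infty)$; $v_t=\int_BG(x-y)(v(y,t)-v(x,t))\,dy+\int_AJ(x-y)(u(y,t)-v(x,t))\,dy$ in $B\times(0,\infty)$, $v(\cdot,0)=v_0$. The solution is the unique pair $u\in C([0,\infty);H^1(A))$, $v\in C([0,\infty);L^2(B))$ such that for each $t$ the function $u(\cdot,t)$ is the weak ($H^1(A)$)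 solution of the elliptic Neumann problem, and $v$ satisfies the time-integrated form of its equation in $L^2(B)$. *)

(* Defs.v *)
From HB Require Import structures.
From mathcomp Require Import all_boot all_order all_algebra.
From mathcomp Require Import all_classical all_reals all_analysis.

Set Implicit Arguments.
Unset Strict Implicit.
Unset Printing Implicit Defensive.

Import Order.TTheory GRing.Theory Num.Theory.
Import numFieldNormedType.Exports.

Local Open Scope classical_set_scope.
Local Open Scope ring_scope.

(** * Lebesgue measure on R^n *)

Definition measure_rV_display : measure_display -> measure_display.
Proof. exact. Qed.

(** The product sigma-algebra on ['rV[R]_n], i.e. the one generated by the
    coordinate maps; it coincides with the Borel sigma-algebra. *)
Section measurable_rV.
Context (R : realType) (n : nat).

Let coords (i : 'I_n) (x : 'rV[R]_n) : measurableTypeR R := x ord0 i.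

Let rV_set0 : g_sigma_preimage coords set0.
Proof. exact: sigma_algebra0. Qed.

Let rV_setC A : g_sigma_preimage coords A -> g_sigma_preimage coords (~` A).
Proof. exact: sigma_algebraC. Qed.

Let rV_bigcup (F : _^nat) : (forall i, g_sigma_preimage coords (F i)) ->
  g_sigma_preimage coords (\bigcup_i (F i)).
Proof. exact: sigma_algebra_bigcup. Qed.

HB.instance Definition _ := @isMeasurable.Build
  (measure_rV_display default_measure_display) 'rV[R]_n (g_sigma_preimage coords) rV_set0 rV_setC rV_bigcup.

End measurable_rV.

Section measurable_fun_rV.
Context (R : realType).

Lemma measurable_coord n (i : 'I_n) :
  measurable_fun setT (fun x : 'rV[R]_n => x ord0 i : measurableTypeR R).
Proof.
move=> _ Y mY; rewrite setTI; apply: sub_sigma_algebra => /=.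
rewrite -bigcup_seq/=; exists i => /=; first by rewrite mem_index_enum.
by exists Y => //; rewrite setTI.
Qed.

Lemma measurable_fun_rVP d (T : measurableType d) n (f : T -> 'rV[R]_n) :
  (forall i, measurable_fun setT (fun x => f x ord0 i : measurableTypeR R)) ->
  measurable_fun setT f.
Proof.
move=> mf _ A mA; rewrite setTI.
pose F := image_set_system setT f (@measurable _ T).
suff: F A by rewrite /F /image_set_system/= setTI.
move: A mA; apply: smallest_sub.
  exact/sigma_algebra_image/sigma_algebra_measurable.
move=> B; rewrite -bigcup_seq => -[i _ /= [C mC <-]].
rewrite /F /image_set_system/= !setTI.
by rewrite -[X in measurable X]setTI; exact: mf.
Qed.

Definition cons_rV n (p : measurableTypeR R * 'rV[R]_n) : 'rV[R]_n.+1 :=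
  \row_i oapp (fun j => p.2 ord0 j) p.1 (unlift ord0 i).

Definition uncons_rV n (x : 'rV[R]_n.+1) : measurableTypeR R * 'rV[R]_n :=
  (x ord0 ord0, \row_j x ord0 (lift ord0 j)).

Lemma cons_rVK n : cancel (@cons_rV n) (@uncons_rV n).
Proof.
case=> a x; rewrite /uncons_rV mxE unlift_none/=; congr pair.
by apply/rowP => j; rewrite !mxE liftK.
Qed.

Lemma measurable_cons_rV n : measurable_fun setT (@cons_rV n).
Proof.
apply: measurable_fun_rVP => i.
under eq_fun do rewrite mxE.
case: (unlift ord0 i) => [j|] /=; last exact: measurable_fst.
exact: (measurableT_comp (measurable_coord j) measurable_snd).
Qed.

Lemma measurable_uncons_rV n : measurable_fun setT (@uncons_rV n).
Proof.
apply/measurable_fun_pair => /=; first exact: measurable_coord.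
apply: measurable_fun_rVP => i.
by under eq_fun do rewrite mxE; exact: measurable_coord.
Qed.

End measurable_fun_rV.

(** [lebesgue_rV n] is the iterated product of the one-dimensional Lebesgue
    measure, transported from [R * 'rV_n] to ['rV_n.+1]; [lebesgue_rV_box] gives
    its value on boxes, which characterizes it. *)
Section lebesgue_rV.
Context (R : realType).

Section step.
Context (n : nat) (m : {sigma_finite_measure set 'rV[R]_n -> \bar R}).

Definition lebesgue_step : set 'rV[R]_n.+1 -> \bar R :=
  pushforward (lebesgue_measure \x m)%E (@cons_rV R n).

HB.instance Definition _ := Measure.copy lebesgue_step
  (measure_function_pushforward__canonical__measure_function_Measure
    (lebesgue_measure \x m)%E (@measurable_cons_rV R n)).

Let lebesgue_step_sigma_finite : sigma_finite setT lebesgue_step.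
Proof.
have /sigma_finiteP[F [FT ndF Foo]] := sigma_finiteT (@lebesgue_measure R).
have /sigma_finiteP[G [GT ndG Goo]] := sigma_finiteT m.
exists (fun k => @uncons_rV R n @^-1` (F k `*` G k)).
  rewrite -preimage_bigcup -[LHS](preimage_setT (@uncons_rV R n)).
  congr (_ @^-1` _); apply/esym; rewrite -subTset => -[x y] _.
  have [i _ Fi] : (\bigcup_k F k) x by rewrite -FT.
  have [j _ Gj] : (\bigcup_k G k) y by rewrite -GT.
  exists (maxn i j) => //; split => /=.
  - by move: x Fi; exact/subsetPset/ndF/leq_maxl.
  - by move: y Gj; exact/subsetPset/ndG/leq_maxr.
move=> k; have [mF Fk] := Foo k; have [mG Gk] := Goo k; split.
  rewrite -[X in measurable X]setTI.
  by apply: measurable_uncons_rV => //; exact: measurableX.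
rewrite /lebesgue_step /pushforward -comp_preimage.
rewrite (_ : _ \o _ = id) ?preimage_id; last exact/funext/cons_rVK.
by rewrite product_measure1E// lte_mul_pinfty// ge0_fin_numE.
Qed.

HB.instance Definition _ := Measure_isSigmaFinite.Build _ _ _
  lebesgue_step lebesgue_step_sigma_finite.

End step.

Fixpoint lebesgue_rV (n : nat) : {sigma_finite_measure set 'rV[R]_n -> \bar R} :=
  match n with
  | 0 => dirac (0 : 'rV[R]_0)
  | n.+1 => lebesgue_step (lebesgue_rV n)
  end.


Lemma lebesgue_rVS n (X : set 'rV[R]_n.+1) : lebesgue_rV n.+1 X =
  (lebesgue_measure \x lebesgue_rV n)%E (@cons_rV R n @^-1` X).
Proof. by []. Qed.

Lemma lebesgue_rV_box n (a b : 'rV[R]_n) :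
  (forall i, a ord0 i <= b ord0 i) ->
  lebesgue_rV n
    [set x : 'rV[R]_n | forall i, x ord0 i \in `]a ord0 i, b ord0 i]] =
  (\prod_i (b ord0 i - a ord0 i))%:E.
Proof.
elim: n a b => [|n IHn] a b ab.
  by rewrite big_ord0 /= diracE mem_set//= => -[].
pose tl (x : 'rV[R]_n.+1) := (uncons_rV x).2.
rewrite lebesgue_rVS.
transitivity ((lebesgue_measure \x lebesgue_rV n)%E
  (`]a ord0 ord0, b ord0 ord0]%classic `*`
    [set x : 'rV[R]_n | forall i, x ord0 i \in `]tl a ord0 i, tl b ord0 i]])).
  congr product_measure1; apply/seteqP; split => -[r x] /=.
    move=> h; split; first by have := h ord0; rewrite mxE unlift_none.
    by move=> i; have := h (lift ord0 i); rewrite !mxE liftK.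
  case=> h1 h2 i; rewrite mxE.
  by case: unliftP => [j ->|->] //=; have := h2 j; rewrite !mxE.
rewrite product_measure1E//; last first.
  rewrite (_ : [set _ | _] = \bigcap_(i in [set: 'I_n])
     ((fun x : 'rV[R]_n => x ord0 i : measurableTypeR R) @^-1`
       `]tl a ord0 i, tl b ord0 i]%classic)); last first.
    by apply/seteqP; split => x /= h i; [move=> _; exact: h|exact: h].
  apply: fin_bigcap_measurable => // i _.
  by rewrite -[X in measurable X]setTI; exact: measurable_coord.
rewrite IHn; last by move=> i; rewrite !mxE.
have h : \prod_(i < n) (tl b ord0 i - tl a ord0 i) =
  \prod_(i < n) (b ord0 (lift ord0 i) - a ord0 (lift ord0 i)).
  by apply: eq_bigr => i _; rewrite !mxE.
rewrite h big_ord_recl EFinM; congr (_ * _)%E.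
apply: eq_trans (lebesgue_measure_itv `]a ord0 ord0, b ord0 ord0]) _.
rewrite /= lte_fin; case: ltP => [_|ba]; first by rewrite -EFinD.
have -> : b ord0 ord0 = a ord0 ord0 by apply/le_anti; rewrite ba ab.
by rewrite subrr.
Qed.

End lebesgue_rV.

(** * Function spaces *)

Section function_spaces.
Context (R : realType) (n : nat).
Notation E := 'rV[R]_n.
Notation mu := (lebesgue_rV R n).
Implicit Types (D : set E) (f g phi : E -> R) (Df : 'I_n -> E -> R).

(** A function on [D] is represented by a total function whose values outside
    [D] are irrelevant: it is cut off by [f \_ D] (zero outside [D]). *)
Definition L2 D f : Prop := (f \_ D) \in Lfun mu 2%:E.

Definition l2norm D f : \bar R := 'N[mu]_(2%:E)[EFin \o (f \_ D)].

Definition mean D f : R := (\int[mu]_(x in D) f x) / fine (mu D).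

Definition partial (i : 'I_n) f : E -> R := 'D_(delta_mx ord0 i) f.

(** [C^oo] on R^n: the iterated partial derivatives of all orders exist and are
    (totally) differentiable, hence continuous. *)
Definition smooth f : Prop :=
  forall (s : seq 'I_n) (x : E), differentiable (foldr partial f s) x.

Definition supp f : set E := closure [set x | f x != 0].

Definition test_function D phi : Prop :=
  [/\ smooth phi, compact (supp phi) & supp phi `<=` D].

Definition weak_partial D (i : 'I_n) f g : Prop :=
  forall phi, test_function D phi ->
    \int[mu]_(x in D) (f x * partial i phi x) =
    - \int[mu]_(x in D) (g x * phi x).

(** [f] belongs to [H^1(D)] and [Df] is its weak gradient. *)
Definition H1 D f Df : Prop :=
  L2 D f /\ forall i, L2 D (Df i) /\ weak_partial D i f (Df i).

Definition h1norm D f Df : \bar R :=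
  ((l2norm D f ^+ 2 + \sum_(i < n) l2norm D (Df i) ^+ 2) `^ 2^-1)%E.

(** Curves in [C([0, oo); L^2(D))] and in [C([0, oo); H^1(D))]. *)
Definition continuous_L2 D (w : R -> E -> R) : Prop :=
  forall t, 0 <= t -> L2 D (w t) /\
    l2norm D (w s \- w t) @[s --> within [set s | 0 <= s] (nbhs t)] --> 0%E.

Definition continuous_H1 D (w : R -> E -> R) (Dw : R -> 'I_n -> E -> R) : Prop :=
  forall t, 0 <= t -> H1 D (w t) (Dw t) /\
    h1norm D (w s \- w t) (fun i => Dw s i \- Dw t i)
      @[s --> within [set s | 0 <= s] (nbhs t)] --> 0%E.

(** [I] is the integral over [[0, t]] of the [L^2(D)]-valued function [F],
    as the limit in [L^2(D)] of its Riemann sums over the tagged partitions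
    [0 = p 0 <= tau 0 <= p 1 <= ... <= p m = t] of vanishing mesh. For continuous
    [F] this is the Bochner integral. *)
Definition L2_integral D (F : R -> E -> R) (t : R) (I : E -> R) : Prop :=
  L2 D I /\
  forall e, 0 < e -> exists2 d, 0 < d &
    forall (m : nat) (p tau : nat -> R), p 0%N = 0 -> p m = t ->
      (forall k, (k < m)%N ->
        [/\ p k <= tau k, tau k <= p k.+1 & p k.+1 - p k < d]) ->
      (l2norm D (fun x =>
        \sum_(k < m) (p k.+1 - p k) * F (tau k) x - I x)%R < e%:E)%E.

End function_spaces.

(** * Domains *)

Section domains.
Context (R : realType) (n : nat).
Implicit Types D : set 'rV[R]_n.

Definition domain D : Prop := [/\ open D, D !=set0 & connected D].

(** Near each of its boundary points, [D] is the strict epigraph or hypograph,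
    in the direction of some coordinate [i], of a smooth function of the other
    coordinates. *)
Definition smooth_boundary D : Prop :=
  forall x0, (closure D `\` interior D) x0 ->
    exists (i : 'I_n) (b : bool) (g : 'rV[R]_n.-1 -> R) (r : R),
      [/\ smooth g, 0 < r & forall x, ball x0 r x ->
          (D x <-> g (col' i x) < (-1) ^+ b * x ord0 i)].

End domains.

(** * The coupled system *)

Section coupled_system.
Context (R : realType) (N : nat).
Notation E := 'rV[R]_N.
Notation mu := (lebesgue_rV R N).
Implicit Types (A B D : set E) (J G K : E -> R).

Definition euclidean_norm (x : E) : R := Num.sqrt (\sum_i x ord0 i ^+ 2).

Record coupling_kernel A B K : Prop := {
  kernel_continuous : continuous K;
  kernel_ge0 : forall z, 0 <= K z;
  kernel_radial : forall x y, euclidean_norm x = euclidean_norm y -> K x = K y;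
  kernel_gt0 : 0 < K 0;
  kernel_integral : (\int[mu]_z (K z)%:E = 1)%E;
  kernel_coupling : exists x y, [/\ A x, B y & supp K (x - y)] }.

(** [x |-> \int_D K(x - y) (w(y) - z(x)) dy] *)
Definition nonlocal D K (w z : E -> R) (x : E) : R :=
  \int[mu]_(y in D) (K (x - y) * (w y - z x)).

(** [f] is the weak solution of [0 = Delta f + nonlocal B J w f] in [A] with
    homogeneous Neumann boundary condition; [Df] is the weak gradient of [f]. *)
Definition weak_neumann A B J (w f : E -> R) (Df : 'I_N -> E -> R) : Prop :=
  H1 A f Df /\
  forall phi Dphi, H1 A phi Dphi ->
    \int[mu]_(x in A) (\sum_i Df i x * Dphi i x) =
    \int[mu]_(x in A) (nonlocal B J w f x * phi x).

Definition solution A B J G (v0 : E -> R) (u v : R -> E -> R) : Prop :=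
  exists Du : R -> 'I_N -> E -> R,
  [/\ continuous_H1 A u Du,
      continuous_L2 B v,
      {ae mu, forall x, B x -> v 0 x = v0 x},
      forall t, 0 <= t -> weak_neumann A B J (v t) (u t) (Du t) &
      forall t, 0 <= t ->
        L2_integral B
          (fun s => nonlocal B G (v s) (v s) \+ nonlocal A J (u s) (v s))
          t (v t \- v0)].

End coupled_system.

(* Main.v *)
(** The energy method applies with a coercivity estimate that involves only the
    kernel [G] on [B]: since [G] is bounded below near the origin and [B] is
    open, bounded and connected, any two points of [B] are joined by a chain of
    small balls along which oscillations are controlled by
    [\int_B \int_B G(x - y) (w(y) - w(x))^2], whence a nonlocal Poincare
    inequality.  Testing the Neumann problem with [1] shows that the mean of
    [v] is conserved, and testing it with [u] shows that the coupling with [A]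
    only dissipates [||v - mean||^2]; Gronwall's lemma concludes. *)
Require Import Defs.
From mathcomp Require Import all_boot all_order all_algebra finmap.
From mathcomp Require Import all_classical all_reals all_analysis.
From mathcomp Require Import measurable_realfun ring lra.

Set Implicit Arguments.
Unset Strict Implicit.
Unset Printing Implicit Defensive.

Import Order.TTheory GRing.Theory Num.Theory.
Import numFieldNormedType.Exports.

Local Open Scope classical_set_scope.
Local Open Scope ring_scope.

(** * Lebesgue measure on row vectors *)

(** Elements of [L^2(B)] are total functions whose values off [B] are arbitrary, so the Hilbert
    space argument is run with a possibly degenerate form [ip], bilinear on a subset [S] of a
    module. The evolution equation is given only through limits of Riemann sums: the scalar
    functions [ip (v t) one] and [ip (v t - m *: one) (v t - m *: one)] are differentiated from such
    sums at positive times, and right continuity covers time [0]. Admitting [1] in [H^1(A)] amounts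
    to the vanishing of the integral of a partial derivative of a test function, which comes from
    translation invariance of the iterated product measure. The energy identity for [G] and the
    dissipation for [J] both rest on evenness of the kernels, a consequence of radiality, through an
    exchange of variables. With [k] the Poincare constant, the squared distance to the mean decays
    at rate [k], whence [lambda1 = k / 2]. The prefactor is exactly [1] because subtracting the mean
    is an orthogonal projection and cannot increase the norm of [v0]. *)

Section rV_measure.
Context {R : realType}.

Lemma ball_rVP n (x y : 'rV[R]_n) (e : R) :
  ball x e y <-> 0 < e /\ forall i, `|x ord0 i - y ord0 i| < e.
Proof.
split; first by move=> [e0 h]; split=> // i; exact: h.
by move=> [e0 h]; split=> // i j; rewrite (ord1 i); exact: h.
Qed.

Lemma normr_rV_coord n (x : 'rV[R]_n) i : `|x ord0 i| <= `|x|.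
Proof.
rewrite /Num.norm/= mx_normE.
by apply: (@le_trans _ _ (`|x (ord0, i).1 (ord0, i).2|%:nng)%:num) => //; rewrite num_le; exact: le_bigmax.
Qed.

Lemma measurable_ball_rV n (x : 'rV[R]_n) (e : R) : measurable (ball x e).
Proof.
have [e0|e0] := ltP 0 e; last first.
  by rewrite (_ : ball x e = set0)//; apply/seteqP; split=> // y [/lt_geF]; rewrite e0.
rewrite (_ : ball x e = \bigcap_(i in [set: 'I_n])
   ((fun y : 'rV[R]_n => y ord0 i : measurableTypeR R) @^-1` (ball (x ord0 i) e))).
  apply: fin_bigcap_measurable => // i _.
  rewrite -[X in measurable X]setTI; apply: measurable_coord => //.
  exact: measurable_ball.
apply/seteqP; split => y /=.
  by move=> /ball_rVP[_ h] i _; exact: h.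
by move=> h; apply/ball_rVP; split=> // i; exact: (h i).
Qed.

(** The sigma-algebra is generated by the coordinates, so openness has to be reduced to countably
    many balls: those with rational center and radius [1 / (k + 1)] that fit inside [U]. *)
Lemma open_measurable_rV n (U : set 'rV[R]_n) : open U -> measurable U.
Proof.
move=> oU.
pose c (q : 'rV[rat]_n) : 'rV[R]_n := map_mx ratr q.
rewrite (_ : U = \bigcup_(p in [set p : 'rV[rat]_n * nat |
     ball (c p.1) (p.2.+1%:R^-1) `<=` U]) ball (c p.1) (p.2.+1%:R^-1)).
  rewrite bigcup_mkcond; apply: countable_bigcupT_measurable; first exact: countableP.
  by move=> p; case: ifP => // _; exact: measurable_ball_rV.
apply/seteqP; split => [x Ux|x [p /= pU]]; last exact: pU.
have /nbhs_ballP[e /= e0 xeU] : nbhs x U by exact: open_nbhs_nbhs.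
(* Half of [e]: the rational center lies within one radius of [x], and the points of its ball within
   another. *)
have [k ke] : exists k : nat, k.+1%:R^-1 < e / 2.
  near \oo%classic => k; exists k; near: k.
  exact: near_infty_natSinv_lt (PosNum (divr_gt0 e0 (ltr0n _ 2))).
have k0 : 0 < k.+1%:R^-1 :> R by [].
have /choice[q qP] : forall i, exists q : rat,
    `|ratr q - x ord0 i| < k.+1%:R^-1.
  move=> i.
  have lt_itv : x ord0 i - k.+1%:R^-1 < x ord0 i + k.+1%:R^-1.
    by rewrite ltrBlDr -addrA ltrDl addr_gt0.
  have [q] := rat_in_itvoo lt_itv.
  by rewrite in_itv/= -ltr_distl => ?; exists q.
exists (\row_i q i, k) => /=.
- move=> y /ball_rVP[_ h]; apply: xeU; apply/ball_rVP; split => // i.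
  have := h i; rewrite !mxE/= => h1; have := qP i => h2.
  rewrite distrC in h2; have := ler_distD (ratr (q i)) (x ord0 i) (y ord0 i).
  by move: (k.+1%:R^-1) k0 ke h1 h2 => d *; lra.
- by apply/ball_rVP; split => // i; rewrite !mxE.
Unshelve. all: by end_near. Qed.

Lemma continuous_measurable_rV n (f : 'rV[R]_n -> R) :
  continuous f -> measurable_fun setT f.
Proof.
move=> /continuousP cf; apply: (measurability _ (RGenOpens.measurableE R)).
move=> _ [_ [a [b ->]] <-]; rewrite setTI.
by apply: open_measurable_rV; apply: cf; exact: interval_open.
Qed.

Lemma measurable_addr_rV n (a : 'rV[R]_n) :
  measurable_fun setT (fun x : 'rV[R]_n => x + a).
Proof.
apply: measurable_fun_rVP => i; under eq_fun do rewrite mxE.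
by apply: measurable_funD => //; exact: measurable_coord.
Qed.

Lemma measurable_subr_rV n :
  measurable_fun setT (fun z : 'rV[R]_n * 'rV[R]_n => z.1 - z.2).
Proof.
apply: measurable_fun_rVP => i; under eq_fun do rewrite !mxE.
apply: measurable_funB.
  exact: (measurableT_comp (measurable_coord i) measurable_fst).
exact: (measurableT_comp (measurable_coord i) measurable_snd).
Qed.

Lemma measurable_box n (a b : 'rV[R]_n) :
  measurable [set x : 'rV[R]_n | forall i, x ord0 i \in `]a ord0 i, b ord0 i]].
Proof.
rewrite (_ : [set _ | _] = \bigcap_(i in [set: 'I_n])
   ((fun y : 'rV[R]_n => y ord0 i : measurableTypeR R) @^-1` `]a ord0 i, b ord0 i]%classic)).
  apply: fin_bigcap_measurable => // i _.
  by rewrite -[X in measurable X]setTI; apply: measurable_coord.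
by apply/seteqP; split => x h i; [move=> _; exact: h|exact: h].
Qed.

Lemma lebesgue_rV_bounded n (D : set 'rV[R]_n) : measurable D -> bounded_set D ->
  (lebesgue_rV R n D < +oo)%E.
Proof.
move=> mD [M [Mreal MD]].
(* [bounded_set] only guarantees bounds strictly above [M], such as [|M| + 1]; the extra unit keeps
   points off the open faces of the half-open box. *)
pose a : 'rV[R]_n := const_mx (- (`|M| + 2)).
pose b : 'rV[R]_n := const_mx (`|M| + 2).
have ab i : a ord0 i <= b ord0 i by rewrite !mxE; have := normr_ge0 M; lra.
have := lebesgue_rV_box ab.
set box := [set _ | _] => boxE.
apply: (@le_lt_trans _ _ (lebesgue_rV R n box)); last by rewrite boxE ltry.
apply: le_measure; rewrite ?inE//.
  exact: measurable_box.
move=> x Dx i.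
have : `|x| <= `|M| + 1 by apply: MD => //; have := ler_norm M; lra.
move=> /(le_trans (normr_rV_coord x i)); rewrite in_itv/= !mxE ler_norml => /andP[h1 h2].
by apply/andP; split; lra.
Qed.

Lemma lebesgue_rV_open_gt0 n (U : set 'rV[R]_n) : open U -> U !=set0 ->
  (0 < lebesgue_rV R n U)%E.
Proof.
move=> oU [x Ux].
have /nbhs_ballP[e /= e0 xeU] : nbhs x U by exact: open_nbhs_nbhs.
pose a : 'rV[R]_n := \row_i (x ord0 i - e / 2).
pose b : 'rV[R]_n := \row_i (x ord0 i + e / 2).
have ab i : a ord0 i <= b ord0 i by rewrite !mxE; lra.
have := lebesgue_rV_box ab.
set box := [set _ | _] => boxE.
apply: (@lt_le_trans _ _ (lebesgue_rV R n box)).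
  rewrite boxE lte_fin; apply: prodr_gt0 => i _; rewrite !mxE; lra.
apply: le_measure; rewrite ?inE//; last first.
- move=> y yb; apply: xeU; apply/ball_rVP; split=> // i.
  have := yb i; rewrite in_itv/= !mxE => /andP[h1 h2].
  by rewrite ltr_norml; apply/andP; split; lra.
- exact: open_measurable_rV.
- exact: measurable_box.
Qed.

End rV_measure.

(** * Translation invariance and integrals of derivatives *)

Section translation.
Context {R : realType}.

Lemma measurable_addr_R (a : R) :
  measurable_fun setT (fun x : measurableTypeR R => x + a : measurableTypeR R).
Proof. by apply: measurable_funD. Qed.

Lemma lebesgue_measure_translation (a : R) (X : set (measurableTypeR R)) :
  measurable X ->
  pushforward lebesgue_measure (fun x : measurableTypeR R => x + a : measurableTypeR R) X
  = lebesgue_measure X.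
Proof.
move=> mX; apply/esym.
pose m' := measure_function_pushforward__canonical__measure_function_Measure
    (@lebesgue_measure R) (measurable_addr_R a).
apply: (@lebesgue_measure_unique R m') => // _ [[x y] /= _ <-].
rewrite /m' /= /pushforward.
rewrite (_ : _ @^-1` _ = `]x - a, y - a]%classic); last first.
  apply/seteqP; split=> z /=; rewrite !in_itv/= => /andP[h1 h2]; apply/andP; split; lra.
rewrite !lebesgue_measure_itv/= !lte_fin ltrD2r; case: ifP => // _.
by rewrite -!EFinB; congr EFin; ring.
Qed.

(** By induction on the dimension: the translated measure has the product values on rectangles, and
    a product of sigma-finite measures is determined by them. *)
Lemma lebesgue_rV_translation n (a : 'rV[R]_n) (X : set 'rV[R]_n) :
  measurable X ->
  pushforward (lebesgue_rV R n) (fun x => x + a) X = lebesgue_rV R n X.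
Proof.
elim: n a X => [|n IH] a X mX.
  rewrite /pushforward (_ : _ @^-1` _ = X)//.
  by apply/seteqP; split=> x /=; rewrite (_ : x + a = x)//; apply/rowP => -[].
rewrite /pushforward !lebesgue_rVS.
pose a' : 'rV[R]_n := (uncons_rV a).2.
pose tr (p : measurableTypeR R * 'rV[R]_n) : measurableTypeR R * 'rV[R]_n :=
  (p.1 + a ord0 ord0, p.2 + a').
have mtr : measurable_fun setT tr.
  apply/measurable_fun_pair => /=.
    exact: (measurableT_comp (measurable_addr_R _) measurable_fst).
  exact: (measurableT_comp (measurable_addr_rV a') measurable_snd).
pose m' := measure_function_pushforward__canonical__measure_function_Measure
    (lebesgue_measure \x lebesgue_rV R n)%E mtr.
apply/esym; apply: etrans (@product_measure_unique _ _ _ _ _ lebesgue_measure (lebesgue_rV R n) m' _ _ _) _; last first.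
- rewrite /m' /= /pushforward -comp_preimage; congr (_ _).
  have consD : @cons_rV R n \o tr = (fun p => cons_rV p + a); last first.
    exact: (congr1 (fun f => f @^-1` X)).
  apply/funext => p; apply/rowP => i; rewrite !mxE.
  by case: unliftP => [j ->|->] /=; rewrite ?mxE.
- by rewrite -[X in measurable X]setTI; exact: measurable_cons_rV.
- move=> A B mA mB; rewrite /m' /= /pushforward.
  rewrite (_ : _ @^-1` _ = ((fun x : measurableTypeR R => x + a ord0 ord0 : measurableTypeR R) @^-1` A)
     `*` ((fun x => x + a') @^-1` B)); last by apply/seteqP; split.
  rewrite product_measure1E; last 2 first.
  + by rewrite -[X in measurable X]setTI; exact: measurable_addr_R.
  + by rewrite -[X in measurable X]setTI; exact: measurable_addr_rV.
  rewrite -(IH a' B)// -(lebesgue_measure_translation (a ord0 ord0) mA); reflexivity.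
Qed.

Lemma integral_translation n (a : 'rV[R]_n) (f : 'rV[R]_n -> \bar R) :
  measurable_fun setT f ->
  (\int[lebesgue_rV R n]_x f (x + a)%R = \int[lebesgue_rV R n]_x f x)%E.
Proof.
move=> mf.
pose m' := measure_function_pushforward__canonical__measure_function_Measure
    (lebesgue_rV R n) (measurable_addr_rV a).
have mE A : measurable A -> A `<=` setT -> m' A = lebesgue_rV R n A.
  by move=> mA _; exact: lebesgue_rV_translation.
have ge0E (g : 'rV[R]_n -> \bar R) : measurable_fun setT g -> (forall x, (0 <= g x)%E) ->
    (\int[lebesgue_rV R n]_x g (x + a)%R = \int[lebesgue_rV R n]_x g x)%E.
  move=> mg g0; transitivity (\int[m']_x g x)%E; last exact: eq_measure_integral.
  by rewrite (ge0_integral_pushforward (measurable_addr_rV a)).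
rewrite [LHS]integralE [RHS]integralE; congr (_ - _)%E.
  rewrite -(ge0E (f^\+)%E); first by apply: eq_integral => x _; rewrite !funeposE.
    exact: measurable_funepos.
  by move=> x; exact: funepos_ge0.
rewrite -(ge0E (f^\-)%E); first by apply: eq_integral => x _; rewrite !funenegE.
  exact: measurable_funeneg.
by move=> x; exact: funeneg_ge0.
Qed.

Lemma compact_normr_le n (r : R) : compact [set x : 'rV[R]_n | `|x| <= r].
Proof.
apply: bounded_closed_compact.
  by exists r; split=> [|x rx y /= yr]; rewrite ?num_real// (le_trans yr)// ltW.
by apply: (@preimage_closed _ _ (Num.norm : 'rV[R]_n -> R) [set x | x <= r]);
  [move=> x _; exact: norm_continuous|exact: closed_le].
Qed.

Lemma continuous_bounded_normr_le n (f : 'rV[R]_n -> R) (r : R) : continuous f ->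
  exists2 C : R, 0 <= C & forall x, `|x| <= r -> `|f x| <= C.
Proof.
move=> cf.
have := continuous_compact (continuous_subspaceT cf) (@compact_normr_le n r).
move=> /compact_bounded[M [_ MP]]; exists (`|M| + 1); first by rewrite addr_ge0.
move=> x xr; apply: (MP (`|M| + 1)); last by exists x.
by rewrite ltr_pwDr// ler_norm.
Qed.

Lemma bounded_support_integrable n (f : 'rV[R]_n -> R) (r C : R) :
  measurable_fun setT f -> (forall x, `|f x| <= C) -> (forall x, r < `|x| -> f x = 0) ->
  (lebesgue_rV R n).-integrable setT (EFin \o f).
Proof.
move=> mf fC f0.
pose K : set 'rV[R]_n := [set x | `|x| <= r].
have mK : measurable K.
  rewrite -(setCK K); apply: measurableC; apply: open_measurable_rV.
  by apply: closed_openC; apply: compact_closed => //; exact: compact_normr_le.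
rewrite (_ : EFin \o f = (EFin \o f) \_ K); last first.
  apply/funext => x; rewrite /patch; case: ifPn => // /negP xK /=.
  by rewrite f0// ltNge; apply/negP => xr; apply: xK; exact/mem_set.
apply/(integrable_mkcond _ mK).1/measurable_bounded_integrable => //.
- apply: lebesgue_rV_bounded => //.
  by exists r; split=> [|x rx y /= yr]; rewrite ?num_real// (le_trans yr)// ltW.
- exact: measurable_funTS.
- by exists C; split=> [|x Cx y _ /=]; rewrite ?num_real// (le_trans (fC y))// ltW.
Qed.

(* By translation invariance [t |-> \int f (x + t e)] is constant; differentiate it under the integral sign. *)
Lemma Rintegral_derive_eq0 n (e : 'rV[R]_n) (f : 'rV[R]_n -> R) :
  continuous f -> (forall x, derivable f x e) -> continuous ('D_e f) ->
  bounded_set [set x | f x != 0] ->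
  \int[lebesgue_rV R n]_x 'D_e f x = 0.
Proof.
move=> cf df cDf [M0 [_ bf]].
pose mu := lebesgue_rV R n.
pose M : R := `|M0| + 1.
have supf x : M < `|x| -> f x = 0.
  move=> xM; apply/eqP; apply: contraTT xM => fx; rewrite -leNgt; apply: bf => //.
  by rewrite /M; have := ler_norm M0; lra.
have supDf x : M < `|x| -> 'D_e f x = 0.
  move=> xM; rewrite -(derive_cst (0 : R) x e); apply: near_eq_derive.
  have : \forall y \near x, M < `|y| 
    by apply: (@cvgr_gt _ _ _ (nbhs_filter x) (Num.norm : 'rV[R]_n -> R) `|x|);
      [exact: norm_continuous|].
  by apply: filterS => y /supf.
have [Cf Cf0 fC] := continuous_bounded_normr_le M cf.
have [C C0 DfC] := continuous_bounded_normr_le M cDf.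
have {}DfC x : `|'D_e f x| <= C.
  by have [/DfC//|/supDf ->] := leP `|x| M; rewrite normr0.
pose g (t : R) (x : 'rV[R]_n) : R := f (x + t *: e).
have quotE (t : R) x :
    (fun h : R => h^-1 *: (((fun s : R => g s x) \o shift t) (h *: (1 : R)) - g t x)) =
    (fun h : R => h^-1 *: ((f \o shift (x + t *: e)) (h *: e) - f (x + t *: e))).
  apply/funext => h; rewrite /g /= /shift /=; congr (_ *: (f _ - _)).
  by rewrite scaler1 scalerDl addrCA.
have gder (t : R) x : derivable (fun s : R => g s x) t 1.
  by rewrite /derivable quotE; exact: df.
have gderE (t : R) x : 'D_1 (fun s : R => g s x) t = 'D_e f (x + t *: e).
  by rewrite /derive quotE.
(* For [|t| < 1] all the translates [g t] vanish outside this single larger ball, so one dominating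
   function serves for every [t]. *)
pose M' := M + `|e|.
have normrB (t : R) x : (`]-1, 1[%classic t) -> M' < `|x| -> M < `|x + t *: e|.
  rewrite /= in_itv/= => /andP[t1 t2] xM'.
  have : `|x| <= `|x + t *: e| + `|t *: e|.
    by rewrite -{1}(addrK (t *: e) x); exact: ler_normB.
  have : `|t *: e| <= `|e|.
    by rewrite normrZ ler_piMl// ler_norml; apply/andP; split; exact: ltW.
  move: xM'; rewrite /M'; lra.
have mf : measurable_fun setT f by exact: continuous_measurable_rV.
have intg t : `]-1, 1[%classic t -> mu.-integrable setT (EFin \o g t).
  move=> t1; apply: (@bounded_support_integrable _ _ M' Cf).
  - exact: (measurableT_comp mf (measurable_addr_rV _)).
  - move=> x; have [/fC//|/supf fx] := leP `|x + t *: e| M.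
    by rewrite /g fx normr0.
  - by move=> x /(normrB _ _ t1) /supf.
have gE t : \int[mu]_x g t x = \int[mu]_x f x.
  rewrite /Rintegral; congr fine.
  apply: (integral_translation (t *: e) (f := EFin \o f)).
  by apply/measurable_EFinP.
pose G (x : 'rV[R]_n) : R := if `|x| <= M' then C else 0.
have intG : mu.-integrable setT (EFin \o G).
  apply: (@bounded_support_integrable _ _ M' C).
  - apply: measurable_fun_ifT => //.
    by apply: measurable_fun_ler => //; apply: continuous_measurable_rV; exact: norm_continuous.
  - by move=> x; rewrite /G; case: ifP; rewrite ?normr0// ger0_norm.
  - by move=> x; rewrite /G ltNge => /negbTE ->.
transitivity (\int[mu]_x partial1of2 g 0 x).
  by apply: eq_Rintegral => x _; rewrite /partial1of2 derive1E gderE scale0r addr0.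
rewrite -(@differentiation_under_integral R _ _ mu g setT measurableT 0 (-1) 1 _ intg _ G _ intG).
- rewrite (_ : (fun x' : R => _) = cst (\int[mu]_x f x)); last exact/funext.
  by rewrite derive1_cst.
- by rewrite /= in_itv/= oppr_lt0 ltr01.
- by move=> t y _ _; exact: gder.
- by move=> y; rewrite /G; case: ifP.
- move=> t x t1 _; rewrite /partial1of2 derive1E gderE /G.
  have [_|xM'] := leP `|x| M'; first exact: DfC.
  by rewrite supDf ?normr0//; exact: normrB t1 xM'.
Qed.

End translation.

(** * Square-integrable functions and semi-inner products *)

Section L2_space.
Context {R : realType} {n : nat}.
Notation E := 'rV[R]_n.
Notation mu := (lebesgue_rV R n).
Implicit Types (D : set E) (f g : E -> R).

(** Trades the cut-off function and the finiteness of an extended-real norm for measurability and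
    integrability on [D] alone. *)
Lemma L2P D f : measurable D ->
  L2 D f <-> measurable_fun D f /\ mu.-integrable D (EFin \o (fun x => f x ^+ 2)).
Proof.
move=> mD; have sqE : EFin \o (fun x => (f \_ D) x ^+ 2) =
    (EFin \o (fun x => f x ^+ 2)) \_ D.
  by apply/funext => x; rewrite /= /patch; case: ifP => //=; rewrite expr0n.
split=> [fL2|[mf if2]].
  split.
    by apply/(measurable_restrictT _ mD); move: fL2; rewrite /L2 inE => /andP[]; rewrite inE.
  by apply/(integrable_mkcond _ mD); rewrite -sqE; exact: Lfun2_integrable_sqr.
have mfD : measurable_fun setT (f \_ D) by exact/(measurable_restrictT _ mD).
rewrite /L2 inE; apply/andP; split; rewrite inE//=.
rewrite /finite_norm unlock; apply: poweR_lty.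
move/(integrable_mkcond _ mD) : if2; rewrite -sqE => /integrableP[_].
apply: le_lt_trans; apply: ge0_le_integral => //.
- by move=> x _; exact: poweR_ge0.
- apply: (@measurableT_comp _ _ _ _ _ _ (fun x => x `^ 2)%E) => //.
    exact: measurable_poweR.
  by apply: measurableT_comp => //; exact/measurable_EFinP.
- by apply: measurableT_comp => //; apply/measurable_EFinP; exact: measurable_funX.
- by move=> x _; rewrite /= lee_fin normrX powR_mulrn.
Qed.

Lemma l2normE D f : measurable D -> L2 D f ->
  l2norm D f = (Num.sqrt (\int[mu]_(x in D) (f x * f x)))%:E.
Proof.
move=> mD fL2; have [mf if2] := (L2P f mD).1 fL2.
rewrite /l2norm unlock.
have -> : (\int[mu]_x `|(EFin \o (f \_ D)) x| `^ 2 =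
    \int[mu]_(x in D) (f x * f x)%:E)%E.
  rewrite [RHS]integral_mkcond; apply: eq_integral => x _ /=.
  rewrite /patch; case: ifP => _; last by rewrite normr0 powR0.
  by rewrite powR_mulrn// real_normK ?num_real// expr2.
have -> : (\int[mu]_(x in D) (f x * f x)%:E)%E = (\int[mu]_(x in D) (f x * f x))%:E.
  rewrite /Rintegral fineK//; apply: integrable_fin_num => //.
rewrite poweR_EFin powR12_sqrt//.
by apply: Rintegral_ge0 => x _; rewrite -expr2 sqr_ge0.
Qed.

End L2_space.

Definition ipnorm (R : realType) (V : Type) (ip : V -> V -> R) (x : V) : R :=
  Num.sqrt (ip x x).

(** Modelled on [L^2(D)] for total functions: additivity and homogeneity need integrability, hence
    the predicate [S], whereas symmetry and positivity of the integral hold for all functions.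
    Definiteness fails, since values off [D] or on a null set are not seen. *)
Record semi_inner_product (R : realType) (V : lmodType R)
    (S : V -> Prop) (ip : V -> V -> R) : Prop := {
  sipD : forall x y, S x -> S y -> S (x + y);
  sipZ : forall a x, S x -> S (a *: x);
  sip0 : S 0;
  sip_sym : forall x y, ip x y = ip y x;
  sip_addl : forall x y z, S x -> S y -> S z -> ip (x + y) z = ip x z + ip y z;
  sip_scalel : forall a x z, S x -> S z -> ip (a *: x) z = a * ip x z;
  sip_ge0 : forall x, 0 <= ip x x }.

(** * Cauchy-Schwarz and triangle inequalities for a degenerate form *)

Section semi_inner_product.
Context {R : realType} {V : lmodType R} {S : V -> Prop} {ip : V -> V -> R}.
Hypothesis H : semi_inner_product S ip.
Let SD := sipD H.
Let SZ := sipZ H.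
Let S0 := sip0 H.
Let ipC := sip_sym H.
Let ipDl := sip_addl H.
Let ipZl := sip_scalel H.
Let ip_ge0 := sip_ge0 H.

Local Notation ipnorm := (ipnorm ip).

Lemma sipN x : S x -> S (- x).
Proof. by rewrite -scaleN1r; exact: SZ. Qed.

Lemma sipB x y : S x -> S y -> S (x - y).
Proof. by move=> Sx Sy; apply: SD => //; exact: sipN. Qed.

Lemma sip_sum I (r : seq I) (F : I -> V) : (forall i, S (F i)) -> S (\sum_(i <- r) F i).
Proof. by move=> SF; elim/big_ind : _ => // x y; exact: SD. Qed.

Lemma ipDr x y z : S x -> S y -> S z -> ip z (x + y) = ip z x + ip z y.
Proof. by move=> *; rewrite ipC ipDl// ![ip _ z]ipC. Qed.

Lemma ipZr a x z : S x -> S z -> ip z (a *: x) = a * ip z x.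
Proof. by move=> *; rewrite ipC ipZl// ipC. Qed.

Lemma ipNl x z : S x -> S z -> ip (- x) z = - ip x z.
Proof. by move=> *; rewrite -scaleN1r ipZl// mulN1r. Qed.

Lemma ipBl x y z : S x -> S y -> S z -> ip (x - y) z = ip x z - ip y z.
Proof. by move=> *; rewrite ipDl ?ipNl//; exact: sipN. Qed.

Lemma ipBr x y z : S x -> S y -> S z -> ip z (x - y) = ip z x - ip z y.
Proof. by move=> *; rewrite ipC ipBl// ![ip _ z]ipC. Qed.

Lemma ipnorm_ge0 x : 0 <= ipnorm x. Proof. exact: sqrtr_ge0. Qed.

Lemma sqr_ipnorm x : ipnorm x ^+ 2 = ip x x. Proof. by rewrite sqr_sqrtr. Qed.

Lemma sip_sqr_le x y : S x -> S y -> ip x y ^+ 2 <= ip x x * ip y y.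
Proof.
move=> Sx Sy.
have key a b : 0 <= a ^+ 2 * ip x x + 2 * a * b * ip x y + b ^+ 2 * ip y y.
  have := ip_ge0 (a *: x + b *: y).
  have Sax := SZ a Sx; have Sby := SZ b Sy; have Sab := SD Sax Sby.
  rewrite ipDl// !ipZl// !ipDr// !ipZr// (ipC y x); lra.
have := ip_ge0 x; rewrite le_eqVlt => /predU1P[x0|x0].
  (* Degenerate case [ip x x = 0]: with [c = ip x y] these coefficients turn the quadratic form into
     [- c^4 (ip y y + 2)], which forces [c = 0]. *)
  rewrite -x0 mul0r; have := key (- ip x y * (ip y y + 1)) (ip x y ^+ 2).
  rewrite -x0; have := sqr_ge0 (ip x y); have := ip_ge0 y.
  move: (ip y y) (ip x y) => b c b0 c0; nra.
have := key (- ip x y) (ip x x); move: x0; move: (ip x x) (ip x y) (ip y y) => a c b.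
nra.
Qed.

Lemma sip_le x y : S x -> S y -> `|ip x y| <= ipnorm x * ipnorm y.
Proof.
move=> Sx Sy; rewrite /ipnorm -sqrtrM// -sqrtr_sqr ler_wsqrtr//.
exact: sip_sqr_le.
Qed.

Lemma ipnormD x y : S x -> S y -> ipnorm (x + y) <= ipnorm x + ipnorm y.
Proof.
move=> Sx Sy; rewrite -(@ler_pXn2r _ 2)// ?nnegrE ?addr_ge0 ?ipnorm_ge0//.
rewrite sqr_ipnorm ipDl//; last exact: SD.
rewrite !ipDr// (ipC y x) sqrrD !sqr_ipnorm.
have := sip_le Sx Sy; have := ler_norm (ip x y); lra.
Qed.

Lemma ipnormZ a x : S x -> ipnorm (a *: x) = `|a| * ipnorm x.
Proof.
move=> Sx; rewrite /ipnorm ipZl ?ipZr//; last exact: SZ.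
by rewrite mulrA -expr2 sqrtrM ?sqr_ge0// sqrtr_sqr.
Qed.

Lemma ipnormN x : S x -> ipnorm (- x) = ipnorm x.
Proof. by move=> Sx; rewrite -scaleN1r ipnormZ// normrN1 mul1r. Qed.

Lemma ipnormB x y : S x -> S y -> ipnorm (x - y) <= ipnorm x + ipnorm y.
Proof. by move=> Sx Sy; rewrite -(ipnormN Sy); apply: ipnormD => //; exact: sipN. Qed.

Lemma ipnorm0 : ipnorm 0 = 0.
Proof. by rewrite -(scale0r 0) ipnormZ// normr0 mul0r. Qed.

Lemma ipnorm_sum m (F : 'I_m -> V) : (forall i, S (F i)) ->
  ipnorm (\sum_i F i) <= \sum_i ipnorm (F i).
Proof.
move=> SF; elim: m F SF => [|m IH] F SF; first by rewrite !big_ord0 ipnorm0.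
rewrite !big_ord_recl; apply: (le_trans (ipnormD _ _)) => //; first exact: sip_sum.
by rewrite lerD2l; apply: IH.
Qed.

End semi_inner_product.

(** * Differential inequalities *)

Section real_functions.
Context {R : realType}.
Implicit Types (f : R -> R).

Lemma is_derive_le_dist f (t L : R) :
  (forall e, 0 < e -> exists2 d, 0 < d &
    forall s, `|s - t| < d -> `|f s - f t - (s - t) * L| <= e * `|s - t|) ->
  is_derive t 1 f L.
Proof.
move=> H.
have cv : h^-1 *: (f (h *: (1 : R) + t) - f t) @[h --> 0^'] --> L.
  apply/cvgrPdist_le => e e0; have [d d0 Hd] := H e e0.
  near=> h.
  have h0 : h != 0 by near: h; exact: nbhs_dnbhs_neq.
  have hd : `|h| < d by near: h; exact: dnbhs0_lt.
  rewrite scaler1; have := Hd (h + t); rewrite addrK => /(_ hd).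
  rewrite -(@ler_pM2l _ `|h|^-1) ?invr_gt0 ?normr_gt0// mulrCA mulVf ?normr_eq0// mulr1.
  apply: le_trans; rewrite -normfV -normrM distrC mulrBr mulrA mulVf// mul1r.
  by rewrite /GRing.scale/=.
apply: DeriveDef; first by apply/cvg_ex; exists L.
exact: (cvg_lim _ cv).
Unshelve. all: by end_near. Qed.

(** Differentiability is available at positive times only; the right limit at [0] carries the mean
    value argument to the closed interval. *)
Lemma nonincreasing_derive f (df : R -> R) :
  (forall t : R, 0 < t -> is_derive t 1 f (df t)) -> (forall t : R, 0 < t -> df t <= 0) ->
  f s @[s --> 0^'+] --> f 0 ->
  forall t : R, 0 < t -> f t <= f 0.
Proof.
move=> fdf df0 f0 t t0.
have fd s : 0 < s -> derivable f s 1 by move=> /fdf[].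
have fc s : 0 < s -> {for s, continuous f}.
  by move=> /fd /derivable1_diffP /differentiable_continuous.
apply: (@ler0_derive1_le_cc _ f 0 t).
- by move=> s; rewrite in_itv/= => /andP[/fd].
- move=> s; rewrite in_itv/= => /andP[s0 _].
  by have := df0 s s0; rewrite derive1E; have [_ ->] := fdf s s0.
- apply/continuous_within_itvP => //; split.
  + by move=> s; rewrite in_itv/= => /andP[/fc].
  + exact: f0.
  + by apply: cvg_at_left_filter; exact: fc.
- by rewrite in_itv/= lexx ltW.
- by rewrite in_itv/= lexx ltW.
- exact: ltW.
Qed.

Lemma constant_derive0 f :
  (forall t : R, 0 < t -> is_derive t 1 f 0) ->
  f s @[s --> 0^'+] --> f 0 ->
  forall t : R, 0 < t -> f t = f 0.
Proof.
move=> fd f0 t t0; apply/eqP; rewrite eq_le; apply/andP; split.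
  exact: (@nonincreasing_derive f (fun=> 0)).
rewrite -lerN2; apply: (@nonincreasing_derive (\- f) (fun=> 0)) => //.
  by move=> s /fd ?; rewrite -oppr0; exact: is_deriveN.
exact: cvgN.
Qed.

Lemma gronwall f (df : R -> R) (k : R) :
  (forall t : R, 0 < t -> is_derive t 1 f (df t)) -> (forall t : R, 0 < t -> df t <= - k * f t) ->
  f s @[s --> 0^'+] --> f 0 ->
  forall t : R, 0 < t -> f t <= expR (- k * t) * f 0.
Proof.
move=> fdf dfk f0 t t0.
(* Integrating factor: the derivative of [g] is [expR (k s) (df + k f)], which is nonpositive. *)
pose g s := expR (k * s) * f s.
have dexp (s : R) : is_derive s 1 (fun s : R => expR (k * s)) (k * expR (k * s)).
  have := @is_derive1_comp R expR ( *%R k) s (expR (k * s)) k (is_derive_expR _).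
  rewrite (mulrC k (expR _)); apply.
  have : is_derive s 1 (k *: (id : R -> R)) (k *: (1 : R)) by exact: is_deriveZ.
  by rewrite /GRing.scale/= mulr1.
suff : g t <= g 0.
  rewrite /g mulr0 expR0 mul1r mulNr expRN => gt0.
  by rewrite ler_pdivlMl ?expR_gt0.
apply: (@nonincreasing_derive g (fun s => expR (k * s) *: df s + f s *: (k * expR (k * s)))) => //.
- by move=> s /fdf ?; exact: is_deriveM.
- move=> s /dfk; rewrite /GRing.scale/=; have := expR_gt0 (k * s).
  by move: (expR _) (df s) (f s) => a b c; nra.
- apply: cvgM => //; apply: cvg_at_right_filter.
  have /derivable1_diffP /differentiable_continuous c0 : derivable (fun s : R => expR (k * s)) 0 1.
    by have [] := dexp 0.
  exact: c0.
Qed.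

End real_functions.

(** * Abstract linear evolution *)

Section evolution.
Context {R : realType} {V : lmodType R} {S : V -> Prop} {ip : V -> V -> R}.
Hypothesis H : semi_inner_product S ip.
Local Notation nrm := (ipnorm ip).

Definition ip_continuous (w : R -> V) := forall t, 0 <= t ->
  S (w t) /\ forall e, 0 < e -> exists2 d, 0 < d &
    forall s, 0 <= s -> `|s - t| < d -> nrm (w s - w t) < e.

(** The abstract form of [L2_integral]. Tags are also required to be nonnegative, where [F] takes
    values in [S]; every Riemann sum then lies in [S], where the real seminorm represents
    [l2norm]. *)
Definition ip_integral (F : R -> V) (t : R) (I : V) := S I /\
  forall e, 0 < e -> exists2 d, 0 < d &
    forall (m : nat) (p tau : nat -> R), p 0%N = 0 -> p m = t ->
      (forall k, (k < m)%N ->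
        [/\ p k <= tau k, tau k <= p k.+1 & p k.+1 - p k < d]) ->
      (forall k, 0 <= tau k) ->
      nrm (\sum_(k < m) (p k.+1 - p k) *: F (tau k) - I) < e.

Variables (v F : R -> V) (v0 : V).
Hypothesis vc : ip_continuous v.
Hypothesis Fc : ip_continuous F.
Hypothesis vF : forall t, 0 <= t -> ip_integral F t (v t - v0).

Let Sv t (t0 : 0 <= t) : S (v t) := (vc t0).1.
Let SF t (t0 : 0 <= t) : S (F t) := (Fc t0).1.
Let SI t (t0 : 0 <= t) : S (v t - v0) := (vF t0).1.

(* Two Riemann sums, over [0, a] and over its extension to [0, b], differ by a Riemann sum over [a, b]. *)
Lemma increment_le a b c eps : 0 <= a -> a <= b -> 0 <= c ->
  (forall s, a <= s -> s <= b -> nrm (F s - F c) <= eps) ->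
  nrm (v b - v a - (b - a) *: F c) <= (b - a) * eps.
Proof.
move=> a0 ab c0 Feps; have b0 := le_trans a0 ab.
apply/ler_addgt0Pr => e e0.
have e20 : 0 < e / 2 by rewrite divr_gt0.
have [da da0 Ha] := (vF a0).2 _ e20; have [db db0 Hb] := (vF b0).2 _ e20.
have [M [M0 bda bdb]] : exists M : nat, [/\ 0 < M%:R :> R, b / da < M%:R & b / db < M%:R].
  exists (Num.truncn (Num.max (b / da) (b / db))).+1; rewrite ltr0n.
  have := @truncnS_gt R (Num.max (b / da) (b / db)).
  by rewrite gt_max => /andP[].
(* [M] equal steps over [[0, a]], then [M] over [[a, b]]: [minn k M] freezes the first ramp at [a],
   and truncated subtraction keeps the second at [0] until [k = M]. Both step lengths are at most
   [b / M], so the choice of [M] makes the mesh fine enough for both ends. *)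
pose p k : R := a * (minn k M)%:R / M%:R + (b - a) * (k - M)%:R / M%:R.
have p0 : p 0%N = 0 by rewrite /p min0n sub0n !mulr0 !mul0r addr0.
have pM : p M = a by rewrite /p minnn subnn mulr0 mul0r addr0 mulfK// gt_eqF.
have pMM : p (M + M)%N = b.
  rewrite /p (minn_idPr _) ?leq_addr// addnK !mulfK ?gt_eqF//; ring.
have p_lo k : (k < M)%N -> p k.+1 - p k = a / M%:R.
  move=> kM; rewrite /p !(minn_idPl _)// 1?ltnW//.
  have /eqP -> : (k.+1 - M == 0)%N by rewrite subn_eq0.
  have /eqP -> : (k - M == 0)%N by rewrite subn_eq0 ltnW.
  by rewrite -natr1 !mulr0 mul0r !addr0 -mulrBl -mulrBr addrAC subrr add0r mulr1.
have p_hi k : (M <= k)%N -> p k.+1 - p k = (b - a) / M%:R.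
  move=> kM; rewrite /p !(minn_idPr _)//; last exact: leqW.
  by rewrite subSn// -natr1 opprD addrACA subrr add0r -mulrBl -mulrBr addrAC subrr add0r mulr1.
have p_incr k : 0 <= p k.+1 - p k.
  by case: (ltnP k M) => kM; [rewrite p_lo//|rewrite p_hi//]; apply: divr_ge0; rewrite ?subr_ge0// ltW.
have p_small k d : (b / d < M%:R) -> 0 < d -> p k.+1 - p k < d.
  move=> bd d0; apply: (@le_lt_trans _ _ (b / M%:R)).
    by case: (ltnP k M) => kM; [rewrite p_lo//|rewrite p_hi//]; rewrite ler_pM2r ?invr_gt0//; lra.
  by rewrite ltr_pdivrMr// mulrC -ltr_pdivrMr.
have p_ge0 k : 0 <= p k.
  by elim: k => [|k IH]; rewrite ?p0//; have := p_incr k; lra.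
have Sp k : S (F (p k)) by exact: SF.
have := Ha M p p p0 pM; set Sa := \sum_(k < M) _ => {}Ha.
have {}Ha : nrm (Sa - (v a - v0)) < e / 2.
  apply: Ha => // k _; split => //; first by rewrite -subr_ge0.
  exact: p_small.
have := Hb (M + M)%N p p p0 pMM; rewrite big_split_ord/= -/Sa.
set T := \sum_(i < M) _ => {}Hb.
have {}Hb : nrm (Sa + T - (v b - v0)) < e / 2.
  apply: Hb => // k _; split => //; first by rewrite -subr_ge0.
  exact: p_small.
have TE : T - (b - a) *: F c = \sum_(i < M) ((b - a) / M%:R) *: (F (p (M + i)%N) - F c).
  rewrite -scaler_sumr sumrB sumr_const card_ord scalerBr; congr (_ - _).
    by rewrite scaler_sumr; apply: eq_bigr => i _; rewrite p_hi// leq_addr.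
  by rewrite -[F c *+ M]scaler_nat scalerA divfK// gt_eqF.
have STc : S (T - (b - a) *: F c).
  rewrite TE; apply: (sip_sum H) => i; apply: (sipZ H).
  by apply: (sipB H) => //; exact: SF.
have HT : nrm (T - (b - a) *: F c) <= (b - a) * eps.
  rewrite TE; apply: (le_trans (ipnorm_sum H _)).
    by move=> i; apply: (sipZ H); apply: (sipB H) => //; exact: SF.
  apply: (@le_trans _ _ (\sum_(i < M) (b - a) / M%:R * eps)).
    apply: ler_sum => i _; rewrite (ipnormZ H); last by apply: (sipB H) => //; exact: SF.
    have ba0 : 0 <= (b - a) / M%:R by rewrite divr_ge0 ?subr_ge0.
    rewrite ger0_norm// ler_wpM2l//; apply: Feps.
      by rewrite -pM; elim: (i : nat) => [|k IH]; rewrite ?addn0// addnS;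
        have := p_incr (M + k)%N; lra.
    have : forall k, (k <= M)%N -> p (M + (M - k))%N <= b.
      elim=> [|k IH kM]; first by rewrite subn0 pMM.
      have := p_incr (M + (M - k.+1))%N; rewrite -addnS -subSn// subSS.
      by have := IH (ltnW kM); lra.
    by move=> /(_ (M - i)%N (leq_subr _ _)); rewrite subKn// ltnW.
  by rewrite sumr_const card_ord -[leLHS]mulr_natl mulrA mulrCA divff ?gt_eqF// mulr1.
(* The tail sum over [[a, b]] is controlled by the oscillation of [F]; the other two terms are the
   errors of the long and the short Riemann sum, each below [e / 2]. *)
have -> : v b - v a - (b - a) *: F c =
    (T - (b - a) *: F c) - (Sa + T - (v b - v0)) + (Sa - (v a - v0)).
  rewrite (_ : v b - v a = (v b - v0) - (v a - v0)); last by rewrite opprB addrA subrK.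
  move: (v b - v0) (v a - v0) ((b - a) *: F c) => P Q Y.
  rewrite opprB opprD !addrA (ACl (1*5*4*6*3*7*2)%AC)/=.
  by rewrite subrr add0r addNr add0r.
have SSa : S Sa by apply: (sip_sum H) => i; apply: (sipZ H).
have ST : S T by apply: (sip_sum H) => i; apply: (sipZ H).
have SA : S (Sa - (v a - v0)) by apply: (sipB H) => //; exact: SI.
have SBb : S (Sa + T - (v b - v0)).
  by apply: (sipB H); [exact: (sipD H)|exact: SI].
apply: (le_trans (ipnormD H _ _)) => //; first exact: (sipB H).
have := ipnormB H STc SBb; lra.
Qed.

(** First-order expansion of [v] at [t], standing for [v' = F] in the seminorm. It follows from
    [increment_le] on the interval between [s] and [t], with [F] frozen at [t] and continuity of [F]
    as the oscillation bound. *)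
Lemma near_increment (t e : R) : 0 < t -> 0 < e -> exists2 d, 0 < d &
  forall s, `|s - t| < d ->
    0 <= s /\ nrm (v s - v t - (s - t) *: F t) <= e * `|s - t|.
Proof.
move=> t0 e0; have t0' := ltW t0.
have [d d0 Fd] := (Fc t0').2 _ e0.
(* The minimum with [t] keeps [s] in the half-line where [v] and [F] are controlled. *)
exists (Num.min d t) => [|s]; first by rewrite lt_min d0.
rewrite lt_min => /andP[sd st].
have s0 : 0 <= s by move: st; rewrite ltr_distl => /andP[]; lra.
split => //; have [ts|ts] := leP t s.
  rewrite ger0_norm ?subr_ge0// mulrC; apply: increment_le => // r tr rs.
  apply/ltW/Fd; first exact: le_trans tr.
  by move: sd; rewrite !ger0_norm ?subr_ge0//; lra.
have {}ts := ltW ts.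
rewrite ler0_norm ?subr_le0// mulrC opprB.
rewrite (_ : _ - _ - _ = - (v t - v s - (t - s) *: F t)); last first.
  by rewrite opprB -(opprB t s) scaleNr opprK addrC opprB.
rewrite (ipnormN H); last by do 2?[apply: (sipB H)] => //; [exact: Sv|exact: Sv|apply: (sipZ H); exact: SF].
apply: increment_le => // r sr rt; apply/ltW/Fd; first exact: le_trans sr.
by move: sd; rewrite !ler0_norm ?subr_le0//; lra.
Qed.

Lemma derive_ip (h : V) (t : R) : S h -> 0 < t ->
  is_derive t 1 (fun s : R => ip (v s) h) (ip (F t) h).
Proof.
move=> Sh t0; apply: is_derive_le_dist => e e0.
have e1 : 0 < e / (nrm h + 1) by rewrite divr_gt0// ltr_wpDl// ipnorm_ge0.
have [d d0 Hd] := near_increment t0 e1; exists d => // s /Hd[s0 rs].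
have [Ss St SFt] : [/\ S (v s), S (v t) & S (F t)].
  by split; [exact: Sv|exact/Sv/ltW|exact/SF/ltW].
rewrite -(sip_scalel H)// -!(ipBl H)//; last 2 first.
- exact: (sipB H).
- exact: (sipZ H).
have Sr : S (v s - v t - (s - t) *: F t) by do 2?[apply: (sipB H)] => //; exact: (sipZ H).
apply: (le_trans (sip_le H Sr Sh)).
have h0 := ipnorm_ge0 h (ip := ip).
apply: (@le_trans _ _ (e / (nrm h + 1) * `|s - t| * (nrm h + 1))).
  by apply: ler_pM => //; [exact: ipnorm_ge0|lra].
by rewrite mulrAC divfK// gt_eqF// ltr_wpDl.
Qed.

(** With [y = v s - v t], [z = v t - w] and [r] the first-order remainder of [v], the error in the
    expansion of the square is [2 ip r z + ip y y]: the first term is small by Cauchy-Schwarz, the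
    second is quadratic in [s - t]. *)
Lemma derive_sqr_ipnorm (w : V) (t : R) : S w -> 0 < t ->
  is_derive t 1 (fun s : R => ip (v s - w) (v s - w)) (2 * ip (F t) (v t - w)).
Proof.
move=> Sw t0; apply: is_derive_le_dist => e e0.
set z := v t - w.
have nz0 := ipnorm_ge0 z (ip := ip); have nF0 := ipnorm_ge0 (F t) (ip := ip).
(* The bound [1] gives [nrm y <= (nrm (F t) + 1) |s - t|]; the other bound makes [2 ip r z] at most
   [e / 2 * |s - t|]. The radius chosen next gives the same bound for [ip y y]. *)
pose e1 := Num.min 1 (e / (4 * (nrm z + 1))).
have e10 : 0 < e1 by rewrite lt_min ltr01 divr_gt0//; lra.
have [d d0 Hd] := near_increment t0 e10.
exists (Num.min d (e / (2 * (nrm (F t) + 1) ^+ 2))).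
  by rewrite lt_min d0 divr_gt0// mulr_gt0// exprn_gt0//; lra.
move=> s; rewrite lt_min => /andP[/Hd[s0 rs] sd].
have [Ss St SFt] : [/\ S (v s), S (v t) & S (F t)].
  by split; [exact: Sv|exact/Sv/ltW|exact/SF/ltW].
have Sz : S z by exact: (sipB H).
set y := v s - v t; have Sy : S y by exact: (sipB H).
set r := y - (s - t) *: F t in rs *.
have Sr : S r by apply: (sipB H) => //; exact: (sipZ H).
have -> : v s - w = y + z by rewrite /y /z addrA subrK.
have SsF : S ((s - t) *: F t) by exact: (sipZ H).
have -> : ip (y + z) (y + z) - ip z z - (s - t) * (2 * ip (F t) z) = 2 * ip r z + ip y y.
  have Syz : S (y + z) by exact: (sipD H).
  rewrite (sip_addl H Sy Sz Syz) (ipDr H Sy Sz Sy) (ipDr H Sy Sz Sz) (sip_sym H z y).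
  rewrite /r (ipBl H Sy SsF Sz) (sip_scalel H _ SFt Sz); ring.
have h1 : `|ip r z| <= e1 * `|s - t| * nrm z.
  by apply: (le_trans (sip_le H Sr Sz)); rewrite ler_wpM2r.
have h2 : nrm y <= (nrm (F t) + 1) * `|s - t|.
  have -> : y = r + (s - t) *: F t by rewrite /r subrK.
  apply: (le_trans (ipnormD H Sr SsF)); rewrite (ipnormZ H)//.
  apply: (@le_trans _ _ (1 * `|s - t| + `|s - t| * nrm (F t))).
    rewrite lerD2r; apply: (le_trans rs); rewrite ler_wpM2r//.
    by rewrite ge_min lexx.
  by rewrite mul1r mulrDl mul1r addrC mulrC.
have h3 : ip y y <= e / 2 * `|s - t|.
  rewrite -(sqr_ipnorm H); have y0 := ipnorm_ge0 y (ip := ip).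
  apply: (@le_trans _ _ ((nrm (F t) + 1) ^+ 2 * `|s - t| * `|s - t|)).
    rewrite -mulrA -expr2 -exprMn ler_pXn2r ?nnegrE//.
    by rewrite mulr_ge0// addr_ge0.
  rewrite ler_wpM2r//.
  have F1 : 0 < (nrm (F t) + 1) ^+ 2 by rewrite exprn_gt0//; lra.
  have := ltW sd; rewrite -(ler_pM2l F1 `|s - t|) => h; apply: (le_trans h).
  by rewrite [X in X <= _](_ : _ = e / 2)//; field; rewrite gt_eqF//; lra.
have h4 : e1 * nrm z <= e / 4.
  apply: (@le_trans _ _ (e / (4 * (nrm z + 1)) * (nrm z + 1))).
    by apply: ler_pM; [exact: ltW|exact: nz0|rewrite /e1 ge_min lexx orbT|lra].
  by rewrite [X in X <= _](_ : _ = e / 4)//; field; rewrite gt_eqF//; lra.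
have h5 : e1 * `|s - t| * nrm z <= e / 4 * `|s - t| by rewrite mulrAC ler_wpM2r.
apply: (le_trans (ler_normD _ _)); rewrite normrM (ger0_norm (sip_ge0 H _)) ger0_norm//; lra.
Qed.

End evolution.

(** * Double integrals *)

Section integrable_lemmas.
Context d (T : measurableType d) (R : realType) (mu : {measure set T -> \bar R}).
Implicit Types (D : set T) (f g : T -> R).

Lemma le_integrableR D f g : measurable D -> measurable_fun D f ->
  (forall x, D x -> `|f x| <= g x) -> mu.-integrable D (EFin \o g) ->
  mu.-integrable D (EFin \o f).
Proof.
move=> mD mf fg; apply: le_integrable => //; first exact/measurable_EFinP.
by move=> x Dx; rewrite /= lee_fin (le_trans (fg x Dx))// ler_norm.
Qed.

Lemma integrable_measurableR D f : mu.-integrable D (EFin \o f) -> measurable_fun D f.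
Proof. by move=> /integrableP[/measurable_EFinP]. Qed.

Lemma integrableDR D f g : measurable D -> mu.-integrable D (EFin \o f) ->
  mu.-integrable D (EFin \o g) -> mu.-integrable D (EFin \o (fun x => f x + g x)).
Proof.
move=> mD fi gi; rewrite (_ : EFin \o _ = ((EFin \o f) \+ (EFin \o g))%E).
  exact: integrableD.
by apply/funext => x /=; rewrite EFinD.
Qed.

Lemma integrableZR D f a : measurable D -> mu.-integrable D (EFin \o f) ->
  mu.-integrable D (EFin \o (fun x => a * f x)).
Proof.
move=> mD fi; rewrite (_ : EFin \o _ = (fun x => a%:E * (EFin \o f) x)%E).
  exact: integrableZl.
by apply/funext => x /=; rewrite EFinM.
Qed.

Lemma integrableNR D f : measurable D -> mu.-integrable D (EFin \o f) ->
  mu.-integrable D (EFin \o (fun x => - f x)).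
Proof.
move=> mD fi; rewrite (_ : (fun x => - f x) = (fun x => (-1) * f x)).
  exact: integrableZR.
by apply/funext => x; rewrite mulN1r.
Qed.

Lemma integrableBR D f g : measurable D -> mu.-integrable D (EFin \o f) ->
  mu.-integrable D (EFin \o g) -> mu.-integrable D (EFin \o (fun x => f x - g x)).
Proof. by move=> mD fi gi; apply: integrableDR => //; exact: integrableNR. Qed.

Lemma integrable_abs D f : measurable D -> mu.-integrable D (EFin \o f) ->
  mu.-integrable D (EFin \o (fun x => `|f x|)).
Proof.
move=> mD fi; rewrite (_ : EFin \o _ = (abse \o (EFin \o f))%E); first exact: integrable_abse.
by apply/funext.
Qed.

Lemma integrable_cstR D a : measurable D -> (mu D < +oo)%E ->
  mu.-integrable D (EFin \o (fun=> a)).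
Proof.
move=> mD Doo; apply: measurable_bounded_integrable => //.
by exists `|a|; split=> [|x ax y _ /=]; rewrite ?num_real// ltW.
Qed.

Lemma subset_le_Rintegral (S D : set T) f : measurable S -> measurable D -> S `<=` D ->
  (forall x, D x -> 0 <= f x) -> mu.-integrable D (EFin \o f) ->
  \int[mu]_(x in S) f x <= \int[mu]_(x in D) f x.
Proof.
move=> mS mD SD f0 fi; have fS : mu.-integrable S (EFin \o f) by exact: integrableS fi.
rewrite /Rintegral; apply: fine_le; try exact: integrable_fin_num.
apply: ge0_subset_integral => //; first exact/measurable_EFinP/integrable_measurableR.
Qed.

End integrable_lemmas.

Section double_integrals.
Context d1 d2 (X : measurableType d1) (Y : measurableType d2) (R : realType).
Variables (m1 : {sigma_finite_measure set X -> \bar R}).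
Variables (m2 : {sigma_finite_measure set Y -> \bar R}).
Implicit Types (S : set X) (T : set Y) (h : X * Y -> R).
Local Notation P := (m1 \x m2)%E.

Let cutE S T h : (EFin \o h) \_ (S `*` T) =
  (fun z => if (z.1 \in S) && (z.2 \in T) then (h z)%:E else 0%E).
Proof.
apply/funext => z; rewrite /patch /=.
by rewrite (_ : (z \in S `*` T) = (z.1 \in S) && (z.2 \in T))// in_setX.
Qed.

Let sectionE S T h x : (\int[m2]_y ((EFin \o h) \_ (S `*` T)) (x, y))%E =
  if x \in S then (\int[m2]_(y in T) (h (x, y))%:E)%E else 0%E.
Proof.
under eq_integral do rewrite cutE/=.
case: ifPn => xS /=; last by rewrite integral0.
by rewrite [RHS]integral_mkcond.
Qed.

(** Besides the iterated integral, measurability of the inner integral is recorded: it is the source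
    of measurability of the nonlocal operator. *)
Lemma fubini_Rintegral S T h : measurable S -> measurable T ->
  P.-integrable (S `*` T) (EFin \o h) ->
  [/\ measurable_fun S (fun x => \int[m2]_(y in T) h (x, y)) &
   \int[m1]_(x in S) (\int[m2]_(y in T) h (x, y)) = \int[P]_(z in S `*` T) h z].
Proof.
move=> mS mT /(integrable_mkcond _ (measurableX mS mT)) hi.
have iF := integrable_fubini_F hi.
have EF : fubini_F m2 ((EFin \o h) \_ (S `*` T)) =
    (fun x => \int[m2]_(y in T) (h (x, y))%:E)%E \_ S.
  by apply/funext => x; rewrite /fubini_F sectionE /patch.
rewrite EF in iF; have {}iF := (integrable_mkcond _ mS).2 iF.
have mF := measurable_int _ iF.
have mfF : measurable_fun S (fun x => \int[m2]_(y in T) h (x, y)).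
  exact: (measurableT_comp (fine_measurable measurableT) mF).
split => //; rewrite /Rintegral; congr fine.
rewrite [RHS]integral_mkcond -(integral12_prod_meas1 hi) EF -integral_mkcond.
(* [fine] is faithful only where the inner integral is finite, which is almost everywhere. *)
apply: ae_eq_integral => //; first exact/measurable_EFinP.
have := integrable_ae mS iF; apply: filterS => x /[apply] Fx.
by rewrite fineK.
Qed.
End double_integrals.

Section swap_integrals.
Context d1 d2 (X : measurableType d1) (Y : measurableType d2) (R : realType).
Variables (m1 : {sigma_finite_measure set X -> \bar R}).
Variables (m2 : {sigma_finite_measure set Y -> \bar R}).

Lemma Rintegral_swap (S : set X) (T : set Y) (h : X * Y -> R) :
  measurable S -> measurable T ->
  (m1 \x m2)%E.-integrable (S `*` T) (EFin \o h) ->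
  (m2 \x m1)%E.-integrable (T `*` S) (EFin \o (fun z => h (z.2, z.1))) ->
  \int[(m1 \x m2)%E]_(z in S `*` T) h z = \int[(m2 \x m1)%E]_(z in T `*` S) h (z.2, z.1).
Proof.
move=> mS mT hi hsi; rewrite /Rintegral; congr fine.
rewrite [LHS]integral_mkcond [RHS]integral_mkcond.
move/(integrable_mkcond _ (measurableX mS mT)) : hi => hi.
move/(integrable_mkcond _ (measurableX mT mS)) : hsi => hsi.
rewrite -(integral21_prod_meas1 hi) -(integral12_prod_meas1 hsi).
apply: eq_integral => y _; apply: eq_integral => x _.
by rewrite /patch !in_setX/= andbC.
Qed.

(** Tonelli, after domination by [|M| |f| |g|]. The double integrands of the nonlocal terms are
    combinations of such products, with [1] allowed as a factor. *)
Lemma integrable_prod_kernel (S : set X) (T : set Y) (k : X * Y -> R) (M : R) f g :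
  measurable S -> measurable T -> measurable_fun (S `*` T) k ->
  (forall x y, S x -> T y -> `|k (x, y)| <= M) ->
  m1.-integrable S (EFin \o f) -> m2.-integrable T (EFin \o g) ->
  (m1 \x m2)%E.-integrable (S `*` T) (EFin \o (fun z => k z * f z.1 * g z.2)).
Proof.
move=> mS mT mk kM fi gi; have mST := measurableX mS mT.
have mf : measurable_fun S f by exact: integrable_measurableR fi.
have mg : measurable_fun T g by exact: integrable_measurableR gi.
have mf1 : measurable_fun (S `*` T) (fun z => f z.1).
  apply: (measurable_comp mS _ mf (measurable_funTS measurable_fst)).
  by move=> _ [z [zS _] <-].
have mg2 : measurable_fun (S `*` T) (fun z => g z.2).
  apply: (measurable_comp mT _ mg (measurable_funTS measurable_snd)).
  by move=> _ [z [_ zT] <-].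
have mh : measurable_fun (S `*` T) (fun z => k z * f z.1 * g z.2).
  by apply: measurable_funM => //; exact: measurable_funM.
have {}fi := integrable_abs mS fi; have {}gi := integrable_abs mT gi.
apply: (@le_integrableR _ _ _ _ _ _ (fun z => `|M| * (`|f z.1| * `|g z.2|))) => //.
  move=> [x y] [/= Sx Ty]; rewrite !normrM -mulrA ler_wpM2r ?mulr_ge0//.
  by rewrite (le_trans (kM x y Sx Ty))// ler_norm.
apply: integrableZR => //.
apply/(integrable_mkcond _ mST)/integrable12ltyP.
  apply/(measurable_restrictT _ mST)/measurable_EFinP.
  by apply: measurable_funM; apply: measurableT_comp.
have -> : (fun x => \int[m2]_y `|((EFin \o (fun z => `|f z.1| * `|g z.2|)%R) \_ (S `*` T)) (x, y)|)%E
   = ((fun x => (`|f x|%R%:E * \int[m2]_(y in T) `|g y|%R%:E)%E) \_ S).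
  apply/funext => x; rewrite /patch; case: ifPn => xS; last first.
    under eq_integral do rewrite in_setX/= (negbTE xS)/= normr0.
    by rewrite integral0.
  rewrite -ge0_integralZl//; last first.
    by apply/measurable_EFinP; exact: measurableT_comp.
  rewrite [RHS]integral_mkcond; apply: eq_integral => y _.
  rewrite in_setX/= xS /patch /=; case: ifP => _ /=; rewrite ?normr0//.
  by rewrite /= ger0_norm// mulr_ge0.
rewrite -integral_mkcond ge0_integralZr//; last 2 first.
- by apply/measurable_EFinP; exact: measurableT_comp.
- exact: integral_ge0.
rewrite lte_mul_pinfty//; first exact: integral_ge0.
- exact: integrable_fin_num.
- exact: integrable_lty.
Qed.

End swap_integrals.

(** * The space [L^2(D)] as a semi-inner product space; sets of finite measure *)

Section L2_finite_measure.
Context {R : realType} {n : nat}.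
Notation E := 'rV[R]_n.
Notation mu := (lebesgue_rV R n).
Implicit Types (D : set E) (f g : E -> R).

Definition L2ip D f g : R := \int[mu]_(x in D) (f x * g x).
Local Notation nrm D := (ipnorm (L2ip D)).

Variable D : set E.
Hypothesis mD : measurable D.

Lemma L2_measurable f : L2 D f -> measurable_fun D f.
Proof. by move=> /(L2P _ mD)[]. Qed.

Lemma L2_sqr_integrable f : L2 D f -> mu.-integrable D (EFin \o (fun x => f x ^+ 2)).
Proof. by move=> /(L2P _ mD)[]. Qed.

Lemma L2_mul_integrable f g : L2 D f -> L2 D g ->
  mu.-integrable D (EFin \o (fun x => f x * g x)).
Proof.
move=> fL gL; apply: (@le_integrableR _ _ _ _ _ _ (fun x => f x ^+ 2 + g x ^+ 2)) => //.
- by apply: measurable_funM; exact: L2_measurable.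
- move=> x _; rewrite normrM -(real_normK (num_real (f x))) -(real_normK (num_real (g x))).
  have := normr_ge0 (f x); have := normr_ge0 (g x).
  by move: `|f x| `|g x| => a b a0 b0; have := sqr_ge0 (a - b); nra.
- by apply: integrableDR => //; exact: L2_sqr_integrable.
Qed.

Lemma L2_le f g : measurable_fun D f -> (forall x, D x -> `|f x| <= g x) -> L2 D g ->
  L2 D f /\ nrm D f <= nrm D g.
Proof.
move=> mf fg gL; have fg2 x : D x -> f x ^+ 2 <= g x ^+ 2.
  move=> Dx; rewrite -(real_normK (num_real (f x))) ler_pXn2r ?nnegrE//; first exact: fg.
  exact: le_trans (fg x Dx).
have f2 : mu.-integrable D (EFin \o (fun x => f x ^+ 2)).
  apply: (@le_integrableR _ _ _ _ _ _ (fun x => g x ^+ 2)) => //.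
  - exact: measurable_funX.
  - by move=> x Dx; rewrite ger0_norm ?sqr_ge0//; exact: fg2.
  - exact: L2_sqr_integrable.
split; first by apply/(L2P _ mD).
rewrite /ipnorm ler_wsqrtr// /L2ip; apply: le_Rintegral => //.
exact: L2_sqr_integrable.
Qed.

Lemma L2_semi_inner_product :
  @semi_inner_product R (E -> R^o) (L2 D) (L2ip D).
Proof.
split.
- move=> f g fL gL; apply/(L2P _ mD); split.
    by apply: measurable_funD; exact: L2_measurable.
  rewrite (_ : (fun x => _) = (fun x => f x ^+ 2 + 2 * (f x * g x) + g x ^+ 2)).
    apply: integrableDR; [by []| |exact: L2_sqr_integrable].
    apply: integrableDR; [by []|exact: L2_sqr_integrable|].
    by apply: integrableZR => //; exact: L2_mul_integrable.
  by apply/funext => x; transitivity ((f x + g x) ^+ 2) => //; ring.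
- move=> a f fL; apply/(L2P _ mD); split.
    by apply: measurable_funM => //; exact: L2_measurable.
  rewrite (_ : (fun x => _) = (fun x => a ^+ 2 * f x ^+ 2)).
    by apply: integrableZR => //; exact: L2_sqr_integrable.
  by apply/funext => x; transitivity ((a * f x) ^+ 2) => //; ring.
- apply/(L2P _ mD); split; first exact: measurable_cst.
  rewrite (_ : EFin \o _ = cst 0%E); first exact: integrable0.
  by apply/funext => x /=; rewrite /GRing.zero/= expr0n.
- by move=> f g; apply: eq_Rintegral => x _; rewrite mulrC.
- move=> f g h fL gL hL; rewrite /L2ip -RintegralD//; [|exact: L2_mul_integrable..].
  by apply: eq_Rintegral => x _; rewrite -mulrDl.
- move=> a f g fL gL; rewrite /L2ip -RintegralZl//; last exact: L2_mul_integrable.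
  by apply: eq_Rintegral => x _; rewrite mulrA.
- by move=> f; apply: Rintegral_ge0 => x _; rewrite -expr2 sqr_ge0.
Qed.

Lemma L2_l2norm f : L2 D f -> l2norm D f = (nrm D f)%:E.
Proof. exact: l2normE. Qed.

Lemma eq_ipnorm f g : (forall x, D x -> f x = g x) -> nrm D f = nrm D g.
Proof.
by move=> fg; congr Num.sqrt; apply: eq_Rintegral => x /set_mem Dx; rewrite fg.
Qed.

Hypothesis Doo : (mu D < +oo)%E.

Lemma L2_cst a : L2 D (fun=> a).
Proof. by apply/(L2P _ mD); split; [exact: measurable_cst|exact: integrable_cstR]. Qed.

Lemma L2_integrable f : L2 D f -> mu.-integrable D (EFin \o f).
Proof.
move=> fL; rewrite (_ : f = (fun x => f x * 1)); last by apply/funext => x; rewrite mulr1.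
by apply: L2_mul_integrable => //; exact: L2_cst.
Qed.

Lemma L2_abs f : L2 D f -> L2 D (fun x => `|f x|) /\ nrm D (fun x => `|f x|) = nrm D f.
Proof.
move=> fL; split.
  apply/(L2P _ mD); split; first by apply: measurableT_comp => //; exact: L2_measurable.
  rewrite (_ : (fun x => `|f x| ^+ 2) = (fun x => f x ^+ 2)); first exact: L2_sqr_integrable.
  by apply/funext => x; rewrite real_normK// num_real.
by congr Num.sqrt; apply: eq_Rintegral => x _; rewrite -!expr2 real_normK// num_real.
Qed.

Lemma L1_le_L2 f : L2 D f -> \int[mu]_(x in D) `|f x| <= nrm D (fun=> 1) * nrm D f.
Proof.
move=> fL; have [aL <-] := L2_abs fL; rewrite mulrC.
rewrite (_ : \int[mu]_(x in D) `|f x| = L2ip D (fun x => `|f x|) (fun=> 1)).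
  by apply: le_trans (sip_le L2_semi_inner_product aL (L2_cst 1)); exact: ler_norm.
by apply: eq_Rintegral => x _; rewrite mulr1.
Qed.

End L2_finite_measure.

(** * The nonlocal operator *)

Section nonlocal_operator.
Context {R : realType} {n : nat}.
Notation E := 'rV[R]_n.
Notation mu := (lebesgue_rV R n).
Local Notation nrm D := (ipnorm (L2ip D)).

(** Differences of points of two bounded sets stay in a closed ball, which is compact. *)
Lemma kernel_bounded (K : E -> R) (S D : set E) : continuous K ->
  bounded_set S -> bounded_set D ->
  exists2 M, 0 <= M & forall x y, S x -> D y -> `|K (x - y)| <= M.
Proof.
move=> cK [s [_ Ss]] [d [_ Dd]].
have [M M0 KM] := continuous_bounded_normr_le (`|s| + 1 + (`|d| + 1)) cK.
exists M => // x y Sx Dy; apply: KM; apply: (le_trans (ler_normB _ _)).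
apply: lerD; [apply: Ss Sx|apply: Dd Dy].
  by rewrite ltr_pwDr// ler_norm.
by rewrite ltr_pwDr// ler_norm.
Qed.

Variables (S D : set E) (K : E -> R) (M : R).
Hypotheses (mS : measurable S) (mD : measurable D).
Hypotheses (Soo : (mu S < +oo)%E) (Doo : (mu D < +oo)%E).
Hypothesis cK : continuous K.
Hypothesis M0 : 0 <= M.
Hypothesis KM : forall x y, S x -> D y -> `|K (x - y)| <= M.
Implicit Types w z phi psi : E -> R.

Let mk : measurable_fun setT (fun p : E * E => K (p.1 - p.2)).
Proof. exact: measurableT_comp (continuous_measurable_rV cK) (@measurable_subr_rV R n). Qed.

(** The integrand splits as [K phi(x) w(y)] minus [K (z phi)(x)], and [z phi] is integrable as a
    product of two square-integrable functions. *)
Lemma nonlocal_integrable1 w z phi : L2 D w -> L2 S z -> L2 S phi ->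
  (mu \x mu)%E.-integrable (S `*` D)
    (EFin \o (fun p => K (p.1 - p.2) * (w p.2 - z p.1) * phi p.1)).
Proof.
move=> wL zL pL; have mSD := measurableX mS mD.
rewrite (_ : (fun p => _) = (fun p : E * E => K (p.1 - p.2) * phi p.1 * w p.2 -
    K (p.1 - p.2) * (z p.1 * phi p.1) * 1)); last by apply/funext => p; ring.
have mk' := measurable_funTS mk (D := S `*` D).
apply: integrableBR => //.
  by apply: (integrable_prod_kernel _ _ _ KM) => //; exact: L2_integrable.
apply: (@integrable_prod_kernel _ _ _ _ _ _ _ _ _ _ M (fun x => z x * phi x) (fun=> 1)) => //.
  exact: L2_mul_integrable.
exact: integrable_cstR.
Qed.

Lemma nonlocal_integrable2 w z psi : L2 D w -> L2 S z -> L2 D psi ->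
  (mu \x mu)%E.-integrable (S `*` D)
    (EFin \o (fun p => K (p.1 - p.2) * (w p.2 - z p.1) * psi p.2)).
Proof.
move=> wL zL pL; have mSD := measurableX mS mD.
rewrite (_ : (fun p => _) = (fun p : E * E => K (p.1 - p.2) * 1 * (w p.2 * psi p.2) -
    K (p.1 - p.2) * z p.1 * psi p.2)); last by apply/funext => p; ring.
have mk' := measurable_funTS mk (D := S `*` D).
apply: integrableBR => //.
  apply: (@integrable_prod_kernel _ _ _ _ _ _ _ _ _ _ M (fun=> 1) (fun x => w x * psi x)) => //.
    exact: integrable_cstR.
  exact: L2_mul_integrable.
by apply: (integrable_prod_kernel _ _ _ KM) => //; exact: L2_integrable.
Qed.

Lemma nonlocal_integrand_integrable w z x : L2 D w -> S x ->
  mu.-integrable D (EFin \o (fun y => K (x - y) * (w y - z x))).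
Proof.
move=> wL Sx; have mKx : measurable_fun setT (fun y : E => K (x - y)).
  apply: (measurableT_comp (continuous_measurable_rV cK)).
  apply: measurable_fun_rVP => i; under eq_fun do rewrite !mxE.
  by apply: measurable_funB => //; exact: measurable_coord.
apply: (@le_integrableR _ _ _ _ _ _ (fun y => M * (`|w y| + `|z x|))) => //.
- apply: measurable_funM; first exact: measurable_funTS.
  by apply: measurable_funB => //; exact: L2_measurable.
- move=> y Dy; rewrite normrM ler_pM//; first exact: KM.
  exact: ler_normB.
- apply: integrableZR => //; apply: integrableDR => //; last exact: integrable_cstR.
  by apply: integrable_abs => //; exact: L2_integrable.
Qed.

Lemma nonlocal_pairing w z phi : L2 D w -> L2 S z -> L2 S phi ->
  measurable_fun S (fun x => nonlocal D K w z x * phi x) /\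
  L2ip S (nonlocal D K w z) phi =
    \int[(mu \x mu)%E]_(p in S `*` D) (K (p.1 - p.2) * (w p.2 - z p.1) * phi p.1).
Proof.
move=> wL zL pL.
have [mF FE] := fubini_Rintegral mS mD (nonlocal_integrable1 wL zL pL).
have E1 x : S x -> \int[mu]_(y in D) (K (x - y) * (w y - z x) * phi x) =
    nonlocal D K w z x * phi x.
  by move=> Sx; rewrite RintegralZr//; exact: nonlocal_integrand_integrable.
split.
  by apply: eq_measurable_fun mF => x /set_mem /E1.
by rewrite -FE; apply: eq_Rintegral => x /set_mem /E1.
Qed.

Lemma nonlocal_le w z x : L2 D w -> S x ->
  `|nonlocal D K w z x| <= M * \int[mu]_(y in D) `|w y| + M * fine (mu D) * `|z x|.
Proof.
move=> wL Sx; have wi := nonlocal_integrand_integrable z wL Sx.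
have wi1 := integrable_abs mD (L2_integrable mD Doo wL).
have zi := @integrable_cstR _ _ _ mu D `|z x| mD Doo.
apply: (le_trans (le_normr_Rintegral mD wi)).
apply: (@le_trans _ _ (\int[mu]_(y in D) (M * (`|w y| + `|z x|)))).
  apply: le_Rintegral => //; first exact: integrable_abs.
    by apply: integrableZR => //; exact: integrableDR.
  move=> y Dy; rewrite normrM ler_pM//; first exact: KM.
  exact: ler_normB.
rewrite RintegralZl//; last exact: integrableDR.
by rewrite RintegralD// Rintegral_cst// mulrDr -mulrA (mulrC (fine _)).
Qed.

Lemma nonlocal_L2 w z : L2 D w -> L2 S z -> L2 S (nonlocal D K w z) /\
  nrm S (nonlocal D K w z) <=
    M * nrm D (fun=> 1) * nrm S (fun=> 1) * nrm D w + M * fine (mu D) * nrm S z.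
Proof.
move=> wL zL.
(* Pairing with the constant [1] yields the measurability of the nonlocal term itself. *)
have [mN _] := nonlocal_pairing wL zL (L2_cst mS Soo 1).
have {}mN : measurable_fun S (nonlocal D K w z).
  by apply: eq_measurable_fun mN => x _; rewrite mulr1.
have [aL aE] := L2_abs mS zL.
have H := L2_semi_inner_product mS.
set c1 := M * \int[mu]_(y in D) `|w y|; set c2 := M * fine (mu D).
have c10 : 0 <= c1 by rewrite mulr_ge0// Rintegral_ge0.
have c20 : 0 <= c2 by rewrite mulr_ge0// fine_ge0.
pose g1 : E -> R^o := c1 *: (fun=> 1); pose g2 : E -> R^o := c2 *: (fun x => `|z x|).
have g1L : L2 S g1 by apply: (sipZ H); exact: L2_cst.
have g2L : L2 S g2 by exact: (sipZ H).
have [NL Nle] := @L2_le _ _ S mS (nonlocal D K w z) (g1 + g2) mN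
  ltac:(by move=> x Sx; rewrite /g1 /g2 /= /GRing.add/= /GRing.scale/= /GRing.scale/= mulr1; exact: nonlocal_le) (sipD H g1L g2L).
split=> //; apply: (le_trans Nle); apply: (le_trans (ipnormD H g1L g2L)).
rewrite /g1 /g2 !(ipnormZ H)//; last exact: L2_cst.
rewrite !ger0_norm// aE lerD2r.
rewrite -!mulrA ler_wpM2l// (mulrC (nrm S _)) mulrA ler_wpM2r ?ipnorm_ge0//.
exact: L1_le_L2.
Qed.

(** Joint linearity in [(w, z)], through which the [L^2] bound becomes a Lipschitz estimate. *)
Lemma nonlocalB w z w' z' x : L2 D w -> L2 D w' -> S x ->
  nonlocal D K w z x - nonlocal D K w' z' x = nonlocal D K (w \- w') (z \- z') x.
Proof.
move=> wL wL' Sx; rewrite /nonlocal -RintegralB//; try exact: nonlocal_integrand_integrable.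
by apply: eq_Rintegral => y _ /=; ring.
Qed.

End nonlocal_operator.

(** * Exchange of variables for an even kernel *)

Section nonlocal_duality.
Context {R : realType} {n : nat}.
Notation E := 'rV[R]_n.
Notation mu := (lebesgue_rV R n).
Variables (S D : set E) (K : E -> R) (M : R).
Hypotheses (mS : measurable S) (mD : measurable D).
Hypotheses (Soo : (mu S < +oo)%E) (Doo : (mu D < +oo)%E).
Hypotheses (cK : continuous K) (K_even : forall z, K (- z) = K z).
Hypothesis KM : forall x y, S x -> D y -> `|K (x - y)| <= M.
Implicit Types w z phi : E -> R.

Let KM' x y : D x -> S y -> `|K (x - y)| <= M.
Proof. by move=> Dx Sy; rewrite -K_even opprB; exact: KM. Qed.

(** Exchanging the variables and using [K (- z) = K z] moves a pairing over [S] to the domain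
    [D * S], so that the coupling terms of both equations become integrals over the same product. *)
Lemma nonlocal_pairing_swap w z phi : L2 D w -> L2 S z -> L2 S phi ->
  L2ip S (nonlocal D K w z) phi =
    \int[(mu \x mu)%E]_(p in D `*` S) (K (p.1 - p.2) * (w p.1 - z p.2) * phi p.2).
Proof.
move=> wL zL pL; rewrite (nonlocal_pairing mS mD Soo Doo cK KM wL zL pL).2.
have := nonlocal_integrable2 mD mS Doo Soo cK KM' zL wL pL.
move=> /(integrableNR (measurableX mD mS)) hi.
have hE : (fun p : E * E => - (K (p.1 - p.2) * (z p.2 - w p.1) * phi p.2)) =
    (fun p => K (p.1 - p.2) * (w p.1 - z p.2) * phi p.2).
  by apply/funext => p; ring.
rewrite hE in hi.
have sE : (fun p : E * E => K (p.2 - p.1) * (w p.1 - z p.2) * phi p.2) =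
    (fun p => K (p.1 - p.2) * (w p.1 - z p.2) * phi p.2).
  by apply/funext => p; rewrite -K_even opprB.
rewrite (Rintegral_swap mS mD); first by rewrite /= sE.
- by apply: (nonlocal_integrable1 (M := M)).
- by rewrite /= sE.
Qed.

End nonlocal_duality.

(** * Nonlocal Poincare inequality *)

Section oscillation.
Context {R : realType} {n : nat}.
Notation E := 'rV[R]_n.
Notation mu := (lebesgue_rV R n).
Implicit Types (S T U : set E) (w : E -> R).

Definition osc S T w : R := \int[(mu \x mu)%E]_(p in S `*` T) (w p.2 - w p.1) ^+ 2.

Definition vol S : R := fine (mu S).

Lemma L2_subset S T w : measurable S -> measurable T -> S `<=` T -> L2 T w -> L2 S w.
Proof.
move=> mS mT ST /(L2P _ mT)[mw iw]; apply/(L2P _ mS); split.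
  exact: measurable_funS ST mw.
exact: integrableS iw.
Qed.

Lemma osc_integrable S T w : measurable S -> measurable T ->
  (mu S < +oo)%E -> (mu T < +oo)%E -> L2 S w -> L2 T w ->
  (mu \x mu)%E.-integrable (S `*` T) (EFin \o (fun p => (w p.2 - w p.1) ^+ 2)).
Proof.
move=> mS mT Soo Too wS wT; have mST := measurableX mS mT.
pose K : E -> R := fun=> 1.
have cK : continuous K by exact: cst_continuous.
have KM x y : S x -> T y -> `|K (x - y)| <= 1 by rewrite /K normr1.
rewrite (_ : (fun p => _) = (fun p : E * E => K (p.1 - p.2) * (w p.2 - w p.1) * w p.2 -
  K (p.1 - p.2) * (w p.2 - w p.1) * w p.1)); last by apply/funext => p; rewrite /K; ring.
apply: integrableBR => //.
  by apply: (nonlocal_integrable2 (M := 1)).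
by apply: (nonlocal_integrable1 (M := 1)).
Qed.

Lemma Rintegral_sqrB T w a : measurable T -> (mu T < +oo)%E -> L2 T w ->
  \int[mu]_(y in T) (w y - a) ^+ 2 =
  \int[mu]_(y in T) (w y ^+ 2) - 2 * a * \int[mu]_(y in T) w y + vol T * a ^+ 2.
Proof.
move=> mT Too wT; have w1 := L2_integrable mT Too wT.
have w2 := L2_sqr_integrable mT wT; have c1 := integrable_cstR (a ^+ 2) mT Too.
transitivity (\int[mu]_(y in T) (w y ^+ 2 - 2 * a * w y + a ^+ 2)).
  by apply: eq_Rintegral => y _; ring.
have w1' := integrableZR (2 * a) mT w1.
rewrite RintegralD//; last exact: integrableBR.
by rewrite RintegralB// RintegralZl// Rintegral_cst// (mulrC (a ^+ 2)).
Qed.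

Lemma osc_fubini S T w : measurable S -> measurable T ->
  (mu S < +oo)%E -> (mu T < +oo)%E -> L2 S w -> L2 T w ->
  osc S T w = \int[mu]_(x in S) (\int[mu]_(y in T) (w y - w x) ^+ 2).
Proof.
by move=> *; rewrite (fubini_Rintegral _ _ (osc_integrable _ _ _ _ _ _)).2.
Qed.

(** Expanding the square leaves only volumes, first moments and second moments, so that inequalities
    between oscillations become real algebra. *)
Lemma oscE S T w : measurable S -> measurable T ->
  (mu S < +oo)%E -> (mu T < +oo)%E -> L2 S w -> L2 T w ->
  osc S T w = vol S * \int[mu]_(y in T) (w y ^+ 2)
    - 2 * (\int[mu]_(x in S) w x) * (\int[mu]_(y in T) w y)
    + vol T * \int[mu]_(x in S) (w x ^+ 2).
Proof.
move=> mS mT Soo Too wS wT; rewrite osc_fubini//.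
set aT := \int[mu]_(y in T) (w y ^+ 2); set bT := \int[mu]_(y in T) w y.
transitivity (\int[mu]_(x in S) (aT - 2 * bT * w x + vol T * w x ^+ 2)).
  by apply: eq_Rintegral => x _; rewrite Rintegral_sqrB// -/aT -/bT; ring.
have w1 := integrableZR (2 * bT) mS (L2_integrable mS Soo wS).
have w2 := integrableZR (vol T) mS (L2_sqr_integrable mS wS).
have c1 := integrable_cstR aT mS Soo.
rewrite RintegralD//; last exact: integrableBR.
rewrite RintegralB// !RintegralZl// ?Rintegral_cst//; first by rewrite /vol; ring.
- exact: L2_integrable.
- exact: L2_sqr_integrable.
Qed.

Lemma sqr_Rintegral_le S w : measurable S -> (mu S < +oo)%E -> L2 S w ->
  (\int[mu]_(x in S) w x) ^+ 2 <= vol S * \int[mu]_(x in S) (w x ^+ 2).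
Proof.
move=> mS Soo wS.
have := sip_sqr_le (L2_semi_inner_product mS) wS (L2_cst mS Soo 1).
rewrite /L2ip Rintegral_cst// !mul1r mulrC.
by under [X in X ^+ 2 <= _]eq_Rintegral do rewrite mulr1.
Qed.

Lemma osc_sym S T w : measurable S -> measurable T ->
  (mu S < +oo)%E -> (mu T < +oo)%E -> L2 S w -> L2 T w ->
  osc S T w = osc T S w.
Proof. by move=> *; rewrite !oscE//; ring. Qed.

(** This is [(w z - w x)^2 <= 2 (w y - w x)^2 + 2 (w z - w y)^2] integrated over the triple product;
    working with moments avoids a triple integral. *)
Lemma osc_trans S T U w : measurable S -> measurable T -> measurable U ->
  (mu S < +oo)%E -> (mu T < +oo)%E -> (mu U < +oo)%E ->
  0 < vol S -> 0 < vol T -> 0 < vol U -> L2 S w -> L2 T w -> L2 U w ->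
  vol T * osc S U w <= 2 * vol U * osc S T w + 2 * vol S * osc T U w.
Proof.
move=> mS mT mU Soo Too Uoo; have := sqr_Rintegral_le mS Soo; move=> /(_ w) hS.
have := sqr_Rintegral_le mT Too; move=> /(_ w) hT.
have := sqr_Rintegral_le mU Uoo; move=> /(_ w) hU.
move=> s0 t0 u0 wS wT wU; rewrite !oscE//.
move: (hS wS) (hT wT) (hU wU) s0 t0 u0.
move: (vol S) (vol T) (vol U) => s t u.
move: (\int[mu]_(x in S) w x) (\int[mu]_(x in T) w x) (\int[mu]_(x in U) w x) => bS bT bU.
move: (\int[mu]_(x in S) _) (\int[mu]_(x in T) _) (\int[mu]_(x in U) _) => aS aT aU.
move=> {}hS {}hT {}hU s0 t0 u0.
rewrite -subr_ge0.
(* The gap is a positive combination of the three Cauchy-Schwarz defects plus the square of a second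
   difference of the averages. *)
have ->: 2 * u * (s * aT - 2 * bS * bT + t * aS) + 2 * s * (t * aU - 2 * bT * bU + u * aT)
   - t * (s * aU - 2 * bS * bU + u * aS) =
   (u * t / s) * (s * aS - bS ^+ 2) + (4 * u * s / t) * (t * aT - bT ^+ 2)
   + (s * t / u) * (u * aU - bU ^+ 2)
   + s * t * u * (bS / s + bU / u - 2 * (bT / t)) ^+ 2.
  by field; rewrite !gt_eqF.
do 3?[apply: addr_ge0]; apply: mulr_ge0; rewrite ?subr_ge0 ?sqr_ge0//;
  by rewrite ?divr_ge0// ?mulr_ge0// ltW.
Qed.

(** The two sets may overlap: [S'] is first cut down to its part off [S], and the integrand is
    nonnegative. *)
Lemma osc_setU S S' T w : measurable S -> measurable S' -> measurable T ->
  (mu S < +oo)%E -> (mu S' < +oo)%E -> (mu T < +oo)%E ->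
  L2 (S `|` S') w -> L2 T w ->
  osc (S `|` S') T w <= osc S T w + osc S' T w.
Proof.
move=> mS mS' mT Soo S'oo Too wU wT; have mU := measurableU _ _ mS mS'.
have Uoo : (mu (S `|` S') < +oo)%E.
  by rewrite (le_lt_trans (measureU2 _ mS mS'))// lte_add_pinfty.
have wS : L2 S w by apply: L2_subset wU => //; exact: subsetUl.
have wS' : L2 S' w by apply: L2_subset wU => //; exact: subsetUr.
have mD : measurable (S' `\` S) by exact: measurableD.
have SE : S `|` S' = S `|` (S' `\` S) by rewrite setUDr setDv setD0.
rewrite !osc_fubini//.
set h := fun x => _.
have h0 x : 0 <= h x by apply: Rintegral_ge0 => y _; exact: sqr_ge0.
have hi : mu.-integrable (S `|` S') (EFin \o h).
  rewrite (_ : h = (fun x => \int[mu]_(y in T) (w y ^+ 2) - 2 * \int[mu]_(y in T) w y * w x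
     + vol T * w x ^+ 2)); last first.
    by apply/funext => x; rewrite /h Rintegral_sqrB//; ring.
  apply: integrableDR => //; last first.
    by apply: integrableZR => //; exact: L2_sqr_integrable.
  apply: integrableBR => //; first exact: integrable_cstR.
  by apply: integrableZR => //; exact: L2_integrable.
rewrite SE Rintegral_setU//; last 2 first.
- by rewrite -SE.
- by apply/disj_setPS => x [Sx []].
rewrite lerD2l; apply: subset_le_Rintegral => //.
  by move=> x _; exact: h0.
by apply: integrableS hi => //; exact: subsetUr.
Qed.

End oscillation.

(** * The energy of the kernel and chains of cells *)

Section nonlocal_poincare.
Context {R : realType} {n : nat}.
Notation E := 'rV[R]_n.
Notation mu := (lebesgue_rV R n).

Definition energy (B : set E) (G : E -> R) (w : E -> R) : R :=
  \int[(mu \x mu)%E]_(p in B `*` B) (G (p.1 - p.2) * (w p.2 - w p.1) ^+ 2).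

Variables (B : set E) (G : E -> R).
Hypotheses (oB : open B) (B0 : B !=set0) (conB : connected B) (bB : bounded_set B).
Hypotheses (cG : continuous G) (G_ge0 : forall z, 0 <= G z) (G0 : 0 < G 0).
Hypothesis G_even : forall z, G (- z) = G z.

Let mB : measurable B. Proof. exact: open_measurable_rV. Qed.
Let Boo : (mu B < +oo)%E. Proof. exact: lebesgue_rV_bounded. Qed.

Let subset_fin S : measurable S -> S `<=` B -> (mu S < +oo)%E.
Proof. by move=> mS SB; apply: le_lt_trans Boo; apply: le_measure; rewrite ?inE. Qed.

Lemma energy_integrable w : L2 B w ->
  (mu \x mu)%E.-integrable (B `*` B)
    (EFin \o (fun p => G (p.1 - p.2) * (w p.2 - w p.1) ^+ 2)).
Proof.
move=> wB; have mBB := measurableX mB mB.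
have [M M0 GM] := kernel_bounded cG bB bB.
rewrite (_ : (fun p => _) = (fun p : E * E => G (p.1 - p.2) * (w p.2 - w p.1) * w p.2 -
  G (p.1 - p.2) * (w p.2 - w p.1) * w p.1)); last by apply/funext => p; ring.
apply: integrableBR => //.
  by apply: (nonlocal_integrable2 (M := M)).
by apply: (nonlocal_integrable1 (M := M)).
Qed.

Lemma energy_ge0 w : 0 <= energy B G w.
Proof. by apply: Rintegral_ge0 => p _; rewrite mulr_ge0// sqr_ge0. Qed.

(** Averaging the pairing with its copy under exchange of the variables completes the square;
    [energy] carries no factor [1/2], hence the [2] on the left. *)
Lemma nonlocal_energy w : L2 B w -> 2 * L2ip B (nonlocal B G w w) w = - energy B G w.
Proof.
move=> wB; have mBB := measurableX mB mB.
have [M M0 GM] := kernel_bounded cG bB bB.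
have i1 := nonlocal_integrable1 mB mB Boo Boo cG GM wB wB wB.
have i2 := nonlocal_integrable2 mB mB Boo Boo cG GM wB wB wB.
rewrite (_ : 2 = 1 + 1)// mulrDl !mul1r.
rewrite [X in X + _](nonlocal_pairing mB mB Boo Boo cG GM wB wB wB).2.
rewrite [X in _ + X](nonlocal_pairing_swap mB mB Boo Boo cG G_even GM wB wB wB).
have -> : (fun p : E * E => G (p.1 - p.2) * (w p.1 - w p.2) * w p.2) =
    (fun p => - (G (p.1 - p.2) * (w p.2 - w p.1) * w p.2)) by apply/funext => p; ring.
rewrite -RintegralD//; last exact: integrableNR.
rewrite /energy -mulN1r -RintegralZl//; last exact: energy_integrable.
by apply: eq_Rintegral => p _; ring.
Qed.

(** The double integrand is antisymmetric under exchange of the variables, so the pairing equals its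
    own opposite. *)
Lemma nonlocal_mean0 w : L2 B w -> L2ip B (nonlocal B G w w) (fun=> 1) = 0.
Proof.
move=> wB; have mBB := measurableX mB mB; have L1 := L2_cst mB Boo 1.
have [M M0 GM] := kernel_bounded cG bB bB.
have i1 := nonlocal_integrable1 mB mB Boo Boo cG GM wB wB L1.
suff : L2ip B (nonlocal B G w w) (fun=> 1) = - L2ip B (nonlocal B G w w) (fun=> 1).
  by move=> h; lra.
rewrite {1}(nonlocal_pairing mB mB Boo Boo cG GM wB wB L1).2.
rewrite (nonlocal_pairing_swap mB mB Boo Boo cG G_even GM wB wB L1).
rewrite -mulN1r -RintegralZl//.
  by apply: eq_Rintegral => p _; ring.
rewrite (_ : (fun p => _) = (fun p : E * E => - (G (p.1 - p.2) * (w p.2 - w p.1) * 1))).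
  exact: integrableNR.
by apply/funext => p; ring.
Qed.

Lemma osc_le_energy S T c w : measurable S -> measurable T -> S `<=` B -> T `<=` B ->
  (forall x y, S x -> T y -> c <= G (x - y)) -> L2 B w ->
  c * osc S T w <= energy B G w.
Proof.
move=> mS mT SB TB cG' wB.
have mST := measurableX mS mT; have mBB := measurableX mB mB.
have oi := osc_integrable mS mT (subset_fin mS SB) (subset_fin mT TB)
  (L2_subset mS mB SB wB) (L2_subset mT mB TB wB).
have STB : S `*` T `<=` B `*` B by move=> p [/SB ? /TB ?].
have ei := energy_integrable wB.
rewrite /osc -RintegralZl//.
apply: (@le_trans _ _ (\int[(mu \x mu)%E]_(p in S `*` T) (G (p.1 - p.2) * (w p.2 - w p.1) ^+ 2))).
  apply: le_Rintegral => //.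
  - exact: integrableZR.
  - exact: integrableS ei.
  - by move=> [x y] [/= Sx Ty]; rewrite ler_wpM2r ?sqr_ge0//; exact: cG'.
apply: subset_le_Rintegral => //.
by move=> p _; rewrite mulr_ge0// sqr_ge0.
Qed.

Let vol_gt0 S : open S -> S !=set0 -> S `<=` B -> 0 < vol S.
Proof.
move=> oS S0 SB; have mS := open_measurable_rV oS.
by rewrite /vol fine_gt0// lebesgue_rV_open_gt0// subset_fin.
Qed.

(* A set is good when it is connected to the cell T by a chain of sets along which the kernel is bounded below. *)
Let good (T S : set E) := exists2 C, 0 <= C & forall w, L2 B w ->
  osc S T w <= C * energy B G w.

(** Goodness passes between cells with centers closer than [2 r], so the centers of good cells form
    a relatively clopen subset of [B]; finitely many cells then exhaust [B]. *)
Lemma nonlocal_poincare_cell : exists T : set E,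
  [/\ open T, T !=set0, T `<=` B & good T B].
Proof.
have [x0 Bx0] := B0.
(* Cells have radius [r] and neighboring centers are within [2 r], so points of neighboring cells
   differ by less than [r + 2 r + r]. *)
have [r r0 Gr] : exists2 r, 0 < r & forall z : E, ball (0 : E) (4 * r) z -> G 0 / 2 <= G z.
  have : \forall z \near (0 : E), G 0 / 2 < G z.
    by apply: (@cvgr_gt _ _ _ (nbhs_filter (0 : E)) G (G 0)); [exact: cG|rewrite ltr_pdivrMr// ltr_pMr// ltr1n].
  move=> /nbhs_ballP[e /= e0 He]; exists (e / 4); first by rewrite divr_gt0.
  by move=> z; rewrite mulrC divfK// => /He/ltW.
pose C x := ball x r `&` B.
have oC x : open (C x) by apply: openI => //; exact: ball_open.
have mC x : measurable (C x) by exact: open_measurable_rV.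
have CB x : C x `<=` B by move=> y [].
have C0 x : B x -> C x !=set0 by move=> Bx; exists x; split => //; exact: ballxx.
have near x y : ball x (2 * r) y -> forall p q, C x p -> C y q -> G 0 / 2 <= G (p - q).
  move=> xy p q [xp _] [yq _]; apply: Gr; apply/ball_rVP; split=> [|i]; first lra.
  move/ball_rVP : xy => [_ /(_ i) h1]; move/ball_rVP : xp => [_ /(_ i) h2].
  move/ball_rVP : yq => [_ /(_ i) h3]; rewrite !mxE.
  move: h1 h2 h3; rewrite !ltr_norml => /andP[? ?] /andP[? ?] /andP[? ?].
  by apply/andP; split; lra.
have L2C x w : L2 B w -> L2 (C x) w by move=> wB; exact: L2_subset wB.
have Coo x : (mu (C x) < +oo)%E by exact: subset_fin.
have c0 : 0 < G 0 / 2 by rewrite divr_gt0.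
have step x y : B x -> B y -> ball x (2 * r) y -> good (C x0) (C x) -> good (C x0) (C y).
  move=> Bx By xy [c cc xc].
  have [s0 t0 u0] : [/\ 0 < vol (C y), 0 < vol (C x) & 0 < vol (C x0)].
    by split; apply: vol_gt0 => //; exact: C0.
  (* The constant given by [osc_trans] through the cell of [x], with the neighboring pair bounded by
     the energy over [G 0 / 2] and the other pair by [c]. *)
  exists ((2 * vol (C x0) / (G 0 / 2) + 2 * vol (C y) * c) / vol (C x)).
    apply: divr_ge0; last exact: ltW.
    apply: addr_ge0; last by rewrite mulr_ge0// mulr_ge0// ltW.
    by apply: divr_ge0; [rewrite mulr_ge0// ltW|exact: ltW].
  move=> w wB; have := osc_trans (mC y) (mC x) (mC x0) (Coo y) (Coo x) (Coo x0) s0 t0 u0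
    (L2C _ _ wB) (L2C _ _ wB) (L2C _ _ wB).
  have h1 : G 0 / 2 * osc (C y) (C x) w <= energy B G w.
    by apply: osc_le_energy => //; apply: near; exact: ball_sym.
  have {}h1 : osc (C y) (C x) w <= energy B G w / (G 0 / 2).
    by rewrite ler_pdivlMr// mulrC.
  have h2 := xc w wB => h3.
  rewrite mulrAC ler_pdivlMr// mulrC (le_trans h3)//.
  apply: (@le_trans _ _ (2 * vol (C x0) * (energy B G w / (G 0 / 2)) +
      2 * vol (C y) * (c * energy B G w))).
    by apply: lerD; rewrite ler_wpM2l// mulr_ge0// ltW.
  by rewrite le_eqVlt; apply/orP; left; apply/eqP; field; rewrite gt_eqF.
have ball_refl x : ball x (2 * r) x by apply: ballxx; lra.
pose Z := [set x | B x /\ good (C x0) (C x)].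
have Zx0 : Z x0.
  split => //; exists (G 0 / 2)^-1; first by rewrite invr_ge0 ltW.
  move=> w wB; rewrite ler_pdivlMl//; apply: osc_le_energy => //; exact: near.
(* Openness and closedness have the same cause: a point of [B] within [r] of a good center is again
   a good center. *)
have ZB : Z = B.
  apply: conB.
  - by exists x0.
  - exists (\bigcup_(x in Z) ball x r); first by apply: bigcup_open => x _; exact: ball_open.
    apply/seteqP; split=> [x Zx|y [By [x Zx xy]]].
      by split; [exact: Zx.1|exists x => //; exact: ballxx].
    split => //; apply: (step x) => //; [exact: Zx.1| |exact: Zx.2].
    by apply: le_ball xy; lra.
  - exists (closure Z); first exact: closed_closure.
    apply/seteqP; split=> [x Zx|y [By Zy]].
      by split; [exact: Zx.1|exact: subset_closure].
    have [x [Zx xy]] := Zy _ (nbhsx_ballx y r r0).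
    split => //; apply: (step x) => //; [exact: Zx.1| |exact: Zx.2].
    by apply: ball_sym; apply: le_ball xy; lra.
have goodB x : B x -> good (C x0) (C x) by rewrite -ZB => -[].
exists (C x0); split => //; first exact: C0.
(* Compactness of the closure gives a finite subcover by balls centered in [B], whose traces on [B]
   are the cells. *)
have cB : compact (closure B).
  have [b [_ Bb]] := bB.
  pose K : set E := [set x | `|x| <= `|b| + 1].
  have cK : compact K by exact: compact_normr_le.
  apply: (subclosed_compact _ cK); first exact: closed_closure.
  have clK : closed K by apply: compact_closed => //; exact: norm_hausdorff.
  rewrite (closure_id K).1//; apply: closure_subset => x Bx.
  by apply: Bb Bx; rewrite ltr_pwDr// ler_norm.
have covB : closure B `<=` cover B (ball ^~ r).
  move=> y By; have [x [Bx xy]] := By _ (nbhsx_ballx y r r0).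
  by exists x => //; exact: ball_sym.
move: cB; rewrite compact_cover => /(_ _ B (ball ^~ r)) => /(_ _ covB)[].
  by move=> x _; exact: ball_open.
move=> D DB BD.
pose U (s : seq E) := \big[setU/set0]_(x <- s) C x.
(* Constants add up along the list of cells, overlaps being harmless by [osc_setU]. *)
have goodU s : (forall x, x \in s -> B x) -> good (C x0) (U s).
  elim: s => [|x s IH] sB.
    exists 0 => // w wB; rewrite /U big_nil /osc set0X Rintegral_set0 mul0r//.
  have [|c c_ge0 Hc] := IH; first by move=> y ys; apply: sB; rewrite inE ys orbT.
  have [c' c'_ge0 Hc'] := goodB x (sB x (mem_head _ _)).
  exists (c' + c) => [|w wB]; first exact: addr_ge0.
  rewrite /U big_cons -/(U s) mulrDl.
  have UB : U s `<=` B by rewrite /U => y; rewrite -bigcup_seq => -[z _ []].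
  have mU : measurable (U s) by rewrite /U; apply: bigsetU_measurable.
  apply: (le_trans (osc_setU _ _ _ _ _ _ _ _)) => //; [exact: subset_fin| | |].
  - by apply: L2_subset wB => //; [exact: measurableU|move=> y [/CB|/UB]].
  - exact: L2C.
  - by apply: lerD; [exact: Hc'|exact: Hc].
suff <- : U (enum_fset D) = B by apply: goodU => x /DB /set_mem.
rewrite /U -bigcup_seq; apply/seteqP; split=> [y [x _ []]//|y By].
have [x xD xy] := BD y (subset_closure By).
by exists x.
Qed.

(** For mean zero, [osc B B w] is [2 vol B] times the squared norm, and [osc_trans] through the cell
    [T] bounds it by [osc B T w]. *)
Lemma nonlocal_poincare : exists2 k, 0 < k & forall w, L2 B w ->
  \int[mu]_(x in B) w x = 0 -> k * L2ip B w w <= energy B G w.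
Proof.
have [T [oT T0 TB [C C_ge0 HC]]] := nonlocal_poincare_cell.
have mT := open_measurable_rV oT; have Too := subset_fin mT TB.
have t0 := vol_gt0 oT T0 TB; have b0 := vol_gt0 oB B0 (@subset_refl _ B).
(* The estimate obtained is [vol T * a <= 2 C e], with [a] the squared norm and [e] the energy; the
   added [1] keeps the quotient meaningful when [C = 0]. *)
exists (vol T / (2 * C + 1)) => [|w wB w0]; first by rewrite divr_gt0//; lra.
have wT := L2_subset mT mB TB wB.
have := osc_trans mB mT mB Boo Too Boo b0 t0 b0 wB wT wB.
rewrite -(osc_sym mB mT Boo Too wB wT) oscE// w0.
have := HC w wB; have := energy_ge0 w; move: (energy _ _ _) (osc _ _ _) => e o e0 oe.
rewrite (_ : \int[mu]_(x in B) (w x ^+ 2) = L2ip B w w)//.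
move: (L2ip _ _ _) => a h.
have {}h : vol B * (vol T * a) <= vol B * (2 * C * e).
  have : vol B * o <= vol B * (C * e) by rewrite ler_pM2l.
  nra.
move: h; rewrite ler_pM2l// => h.
by rewrite mulrAC ler_pdivrMr//; lra.
Qed.

End nonlocal_poincare.

(** * Exponential decay *)

Section exponential_decay.
Context {R : realType} {V : lmodType R} {S : V -> Prop} {ip : V -> V -> R}.
Hypothesis H : semi_inner_product S ip.
Local Notation nrm := (ipnorm ip).

Lemma ipnorm_distl x y : S x -> S y -> `|nrm x - nrm y| <= nrm (x - y).
Proof.
move=> Sx Sy; rewrite ler_distl; apply/andP; split.
  have := ipnormB H Sx (sipB H Sx Sy); rewrite opprB addrC subrK; lra.
by have := ipnormD H (sipB H Sx Sy) Sy; rewrite subrK; lra.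
Qed.

Lemma cvg_ip0 v (h : V) : ip_continuous (S := S) (ip := ip) v -> S h ->
  ip (v s) h @[s --> (0 : R)^'+] --> ip (v 0) h.
Proof.
move=> vc Sh; have [S0 c0] := vc 0 (lexx _).
apply/cvgrPdist_lt => e e0.
have e1 : 0 < e / (nrm h + 1) by rewrite divr_gt0// ltr_wpDl// ipnorm_ge0.
have [d d0 Hd] := c0 _ e1.
near=> s.
have s0 : 0 <= s by near: s; exact: nbhs_right_ge.
have sd : `|s - 0| < d by rewrite subr0 ger0_norm//; near: s; exact: nbhs_right_lt.
have Ss := (vc s s0).1; have Svs := sipB H Ss S0.
rewrite distrC -(ipBl H)//; apply: (le_lt_trans (sip_le H Svs Sh)).
have h0 := ipnorm_ge0 h (ip := ip).
have := Hd s s0 sd; rewrite ltr_pdivlMr; last by lra.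
have := ipnorm_ge0 (v s - v 0) (ip := ip); nra.
Unshelve. all: by end_near. Qed.

Lemma cvg_sqr_ipnorm0 v (w : V) : ip_continuous (S := S) (ip := ip) v -> S w ->
  ip (v s - w) (v s - w) @[s --> (0 : R)^'+] --> ip (v 0 - w) (v 0 - w).
Proof.
move=> vc Sw; have [S0 c0] := vc 0 (lexx _).
under eq_fun do rewrite -(sqr_ipnorm H).
rewrite -(sqr_ipnorm H).
suff cn : nrm (v s - w) @[s --> (0 : R)^'+] --> nrm (v 0 - w) by exact: cvgM.
apply/cvgrPdist_lt => e e0; have [d d0 Hd] := c0 _ e0.
near=> s.
have s0 : 0 <= s by near: s; exact: nbhs_right_ge.
have sd : `|s - 0| < d by rewrite subr0 ger0_norm//; near: s; exact: nbhs_right_lt.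
have Ss := (vc s s0).1; rewrite distrC.
apply: (le_lt_trans (ipnorm_distl (sipB H Ss Sw) (sipB H S0 Sw))).
by rewrite opprB addrA subrK; exact: Hd.
Unshelve. all: by end_near. Qed.

Variables (v F : R -> V) (v0 one : V) (m k : R).
Hypothesis vc : ip_continuous (S := S) (ip := ip) v.
Hypothesis Fc : ip_continuous (S := S) (ip := ip) F.
Hypothesis vF : forall t, 0 <= t -> ip_integral (S := S) (ip := ip) F t (v t - v0).
Hypotheses (Sv0 : S v0) (Sone : S one).
Hypothesis mE : ip (v0 - m *: one) one = 0.
Hypothesis F_one : forall t, 0 <= t -> ip (F t) one = 0.
Hypothesis coercive : forall t, 0 <= t -> ip (v t - m *: one) one = 0 ->
  2 * ip (F t) (v t - m *: one) <= - k * ip (v t - m *: one) (v t - m *: one).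

(** Coercivity is assumed only for states with the right mean, so conservation of [ip (v t) one] has
    to come before the Gronwall argument. *)
Lemma evolution_decay t : 0 < t -> nrm (v t - m *: one) <= expR (- (k / 2) * t) * nrm v0.
Proof.
move=> t0; have SV0 := (vc (lexx 0)).1; have Sm : S (m *: one) by exact: (sipZ H).
(* The partition of [[0, 0]] without intervals has zero sum, so [v 0] and [v0] are at distance zero,
   which replaces equality for a degenerate form. *)
have init : nrm (v 0 - v0) = 0.
  apply/eqP; rewrite eq_le ipnorm_ge0 andbT; apply/ler_addgt0Pr => e e0.
  have [d d0 Hd] := (vF (lexx 0)).2 _ e0.
  have := Hd 0%N (fun=> 0) (fun=> 0) erefl erefl; rewrite big_ord0 [0 - (v 0 - v0)]sub0r (ipnormN H); last exact: (sipB H).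
  by move=> h; rewrite add0r ltW// h.
have mean0 : ip (v 0) one = ip v0 one.
  apply/eqP; rewrite -subr_eq0 -(ipBl H)// -normr_le0.
  by rewrite (le_trans (sip_le H (sipB H SV0 Sv0) Sone))// init mul0r.
have meant s : 0 < s -> ip (v s) one = ip (v 0) one.
  apply: (@constant_derive0 _ (fun s : R => ip (v s) one)); last exact: cvg_ip0.
  by move=> r r0; rewrite -(F_one (ltW r0)); exact: (derive_ip H vc Fc vF).
have zone s : 0 < s -> ip (v s - m *: one) one = 0.
  move=> s0; have Ss := (vc (ltW s0)).1.
  by rewrite (ipBl H)// meant// mean0 -(ipBl H).
pose f s := ip (v s - m *: one) (v s - m *: one).
have decay : f t <= expR (- k * t) * f 0.
  apply: (@gronwall _ f (fun s => 2 * ip (F s) (v s - m *: one))) => //.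
  - by move=> s s0; exact: (derive_sqr_ipnorm H vc Fc vF).
  - by move=> s s0; apply: coercive; [exact: ltW|exact: zone].
  - exact: cvg_sqr_ipnorm0.
pose z0 := v0 - m *: one; have z0E : ip z0 one = 0 by exact: mE.
have Sz0 : S z0 by exact: (sipB H).
have f0 : nrm (v 0 - m *: one) <= nrm v0.
  apply: (@le_trans _ _ (nrm z0)).
    rewrite (_ : v 0 - m *: one = (v 0 - v0) + z0); last by rewrite /z0 addrA subrK.
    by apply: (le_trans (ipnormD H _ _)); rewrite ?init ?add0r//; exact: (sipB H).
  rewrite /ipnorm ler_wsqrtr//.
  (* Pythagoras: [z0] is orthogonal to [one], so [v0] is at least as long as [z0]. *)
  have -> : v0 = z0 + m *: one by rewrite /z0 subrK.
  rewrite (sip_addl H Sz0 Sm (sipD H Sz0 Sm)) (ipDr H Sz0 Sm Sz0) (ipDr H Sz0 Sm Sm).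
  rewrite (sip_scalel H _ Sone Sz0) (ipZr H _ Sone Sz0) (sip_sym H one z0) z0E.
  by have := sip_ge0 H (m *: one); lra.
rewrite -(@ler_pXn2r _ 2)// ?nnegrE ?mulr_ge0 ?expR_ge0 ?ipnorm_ge0//.
rewrite (sqr_ipnorm H) (le_trans decay)// exprMn -expRM_natl.
rewrite (_ : 2%:R * (- (k / 2) * t) = - k * t); last by field.
by rewrite ler_wpM2l ?expR_ge0// /f -(sqr_ipnorm H) ler_pXn2r// nnegrE ipnorm_ge0.
Qed.

End exponential_decay.

(** * The coupled system *)

Section coupled_system_facts.
Context {R : realType} {N : nat}.
Notation E := 'rV[R]_N.
Notation mu := (lebesgue_rV R N).
Local Notation nrm D := (ipnorm (L2ip D)).

(** Zero is the weak gradient of [1] because partial derivatives of test functions integrate to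
    zero. *)
Lemma H1_cst1 (D : set E) : measurable D -> (mu D < +oo)%E ->
  H1 D (fun=> 1) (fun _ _ => 0).
Proof.
move=> mD Doo; split; first exact: L2_cst.
move=> i; split; first exact: L2_cst.
move=> phi [sphi cphi phiD].
have dphi x : differentiable phi x by exact: (sphi [::] x).
have dpphi x : differentiable (partial i phi) x by exact: (sphi [:: i] x).
(* [supp phi] is closed and inside [D], so [phi] vanishes near each point off [D]; the integral over
   [D] is thus one over the whole space. *)
have D0 x : ~ D x -> partial i phi x = 0.
  move=> nDx; rewrite /partial -(derive_cst (0 : R) x (delta_mx ord0 i)).
  apply: near_eq_derive.
  have : (~` supp phi) x by move=> /phiD.
  move=> nsx; have oS : open (~` supp phi) by apply: closed_openC; exact: closed_closure.
  have : nbhs x (~` supp phi) by exact: open_nbhs_nbhs.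
  apply: filterS => y nsy; apply/eqP; rewrite -[_ == _]negbK; apply/negP => phiy.
  by apply: nsy; exact: subset_closure.
have -> : (fun x => 0 * phi x) = (fun=> 0) by apply/funext => x; rewrite mul0r.
rewrite Rintegral_cst// mul0r oppr0.
rewrite Rintegral_mkcond (_ : _ \_ _ = partial i phi); last first.
  apply/funext => x; rewrite /patch; case: ifPn => [_|/negP nDx]; first by rewrite mul1r.
  by rewrite D0// => Dx; apply: nDx; exact/mem_set.
apply: Rintegral_derive_eq0.
- by move=> x; exact: differentiable_continuous.
- by move=> x; exact: diff_derivable.
- by move=> x; exact: (differentiable_continuous (dpphi x)).
- have [M [Mr HM]] := compact_bounded cphi; exists M; split => // r Mr' x phix.
  by apply: HM Mr' _ _; exact: subset_closure.
Qed.

Lemma within_ereal_cvg0 (f : R -> \bar R) (t : R) :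
  f s @[s --> within [set s | 0 <= s] (nbhs t)] --> 0%E ->
  forall e, 0 < e -> exists2 d, 0 < d &
    forall s, 0 <= s -> `|s - t| < d -> (f s < e%:E)%E.
Proof.
move=> f0 e e0.
have : nbhs (0 : \bar R)%E [set x | (x < e%:E)%E].
  by apply: open_nbhs_nbhs; split; [exact: open_ereal_lt_ereal|rewrite /= lte_fin].
move=> /f0; rewrite /= near_simpl => /nbhs_ballP[d /= d0 Hd].
by exists d => // s s0 sd; apply: Hd => //; rewrite /ball/= distrC.
Qed.

Lemma continuous_L2_ip (B : set E) (w : R -> E -> R) : measurable B ->
  continuous_L2 B w ->
  @ip_continuous R (E -> R^o) (L2 B) (L2ip B) w.
Proof.
move=> mB wc t t0; have [wL cw] := wc t t0; split => // e e0.
have [d d0 Hd] := within_ereal_cvg0 cw e0; exists d => // s s0 sd.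
have := Hd s s0 sd; rewrite L2_l2norm// ?lte_fin//.
exact: (sipB (L2_semi_inner_product mB) (wc s s0).1 wL).
Qed.

Lemma continuous_H1_ip (A : set E) (w : R -> E -> R) Dw : measurable A ->
  continuous_H1 A w Dw ->
  @ip_continuous R (E -> R^o) (L2 A) (L2ip A) w.
Proof.
move=> mA wc t t0; have [[wL _] cw] := wc t t0; split => // e e0.
have [d d0 Hd] := within_ereal_cvg0 cw e0; exists d => // s s0 sd.
have sL : L2 A (w s \- w t).
  exact: (sipB (L2_semi_inner_product mA) (wc s s0).1.1 wL).
have := Hd s s0 sd; rewrite -lte_fin -(L2_l2norm mA sL).
apply: le_lt_trans; rewrite /h1norm.
have : (l2norm A (w s \- w t)%R = (l2norm A (w s \- w t)%R ^+ 2) `^ 2^-1)%E.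
  rewrite (L2_l2norm mA sL) -EFin_expe poweR_EFin powR12_sqrt ?sqr_ge0//.
  by rewrite sqrtr_sqr ger0_norm// ipnorm_ge0.
move=> aE; rewrite [leLHS]aE.
have sq0 (x : \bar R) : (0 <= x)%E -> (0 <= x ^+ 2)%E by exact: expe_ge0.
have l0 f : (0 <= l2norm A f)%E by exact: Lnorm_ge0.
have S0 : (0 <= \sum_(i < N) l2norm A (Dw s i \- Dw t i)%R ^+ 2)%E.
  by apply: sume_ge0 => i _; exact: sq0.
apply: gt0_ler_poweR => //.
- by rewrite in_itv/= leey andbT sq0.
- by rewrite in_itv/= leey andbT adde_ge0// sq0.
- exact: leeDl.
Qed.

Lemma L2_integral_ip (B : set E) (F : R -> E -> R) t I : measurable B ->
  (forall s, 0 <= s -> L2 B (F s)) ->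
  L2_integral B F t I -> @ip_integral R (E -> R^o) (L2 B) (L2ip B) F t I.
Proof.
move=> mB FL [IL HI]; split => // e e0; have [d d0 Hd] := HI e e0.
exists d => // m p tau p0 pm ptau tau0.
have := Hd m p tau p0 pm ptau.
have H := L2_semi_inner_product mB.
rewrite (_ : (fun x => _) = (\sum_(k < m) (p k.+1 - p k) *: (F (tau k) : E -> R^o)) - I).
  rewrite L2_l2norm// ?lte_fin//.
  by apply: (sipB H) => //; apply: (sip_sum H) => k; apply: (sipZ H); exact: FL.
apply/funext => x; rewrite [RHS]/GRing.add/= fct_sumE.
done.
Qed.

End coupled_system_facts.

(** * Regularity, conservation and dissipation for the coupled right-hand side *)

Section coupled_dynamics.
Context {R : realType} {N : nat}.
Notation E := 'rV[R]_N.
Notation mu := (lebesgue_rV R N).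
Local Notation nrm D := (ipnorm (L2ip D)).
Variables (A B : set E) (J G : E -> R).
Hypotheses (oA : open A) (oB : open B) (bA : bounded_set A) (bB : bounded_set B).
Hypotheses (cJ : continuous J) (cG : continuous G).
Hypotheses (J_even : forall z, J (- z) = J z) (J_ge0 : forall z, 0 <= J z).

Let mA : measurable A. Proof. exact: open_measurable_rV. Qed.
Let mB : measurable B. Proof. exact: open_measurable_rV. Qed.
Let Aoo : (mu A < +oo)%E. Proof. exact: lebesgue_rV_bounded. Qed.
Let Boo : (mu B < +oo)%E. Proof. exact: lebesgue_rV_bounded. Qed.

Definition coupled_rhs (u v : E -> R) : E -> R :=
  nonlocal B G v v \+ nonlocal A J u v.

Lemma coupled_rhs_L2 u v : L2 A u -> L2 B v -> L2 B (coupled_rhs u v).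
Proof.
move=> uL vL; have [MG MG0 GM] := kernel_bounded cG bB bB.
have [MJ MJ0 JM] := kernel_bounded cJ bB bA.
apply: (sipD (L2_semi_inner_product mB)).
  by have [] := nonlocal_L2 mB mB Boo Boo cG MG0 GM vL vL.
by have [] := nonlocal_L2 mB mA Boo Aoo cJ MJ0 JM uL vL.
Qed.

(** Both nonlocal terms are linear in [(u, v)] and bounded in [L^2]; the constant is the sum of the
    four coefficients in their bounds. *)
Lemma coupled_rhs_lipschitz : exists2 C, 0 <= C & forall u v u' v',
  L2 A u -> L2 B v -> L2 A u' -> L2 B v' ->
  nrm B (coupled_rhs u v \- coupled_rhs u' v') <= C * (nrm A (u \- u') + nrm B (v \- v')).
Proof.
have [MG MG0 GM] := kernel_bounded cG bB bB.
have [MJ MJ0 JM] := kernel_bounded cJ bB bA.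
have HA := L2_semi_inner_product mA; have HB := L2_semi_inner_product mB.
set a1 := nrm A (fun=> 1); set b1 := nrm B (fun=> 1).
have a10 : 0 <= a1 by exact: ipnorm_ge0.
have b10 : 0 <= b1 by exact: ipnorm_ge0.
have vA : 0 <= fine (mu A) by exact: fine_ge0.
have vB : 0 <= fine (mu B) by exact: fine_ge0.
exists (MG * b1 * b1 + MG * fine (mu B) + MJ * fine (mu A) + MJ * a1 * b1).
  by rewrite !addr_ge0 ?mulr_ge0.
move=> u v u' v' uL vL uL' vL'.
have du : L2 A (u \- u') by exact: (sipB HA uL uL').
have dv : L2 B (v \- v') by exact: (sipB HB vL vL').
have [GL Gle] := nonlocal_L2 mB mB Boo Boo cG MG0 GM dv dv.
have [JL Jle] := nonlocal_L2 mB mA Boo Aoo cJ MJ0 JM du dv.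
rewrite (@eq_ipnorm _ _ B _ (nonlocal B G (v \- v') (v \- v') \+ nonlocal A J (u \- u') (v \- v'))).
  apply: (le_trans (ipnormD HB GL JL)).
  have := ipnorm_ge0 (u \- u') (ip := L2ip A); have := ipnorm_ge0 (v \- v') (ip := L2ip B).
  move: Gle Jle; rewrite -/a1 -/b1.
  move: (nrm A _) (nrm B _) (nrm B _) (nrm B _) => x y g j hg hj y0 x0.
  have h1 : 0 <= MG * b1 * b1 by rewrite !mulr_ge0.
  have h2 : 0 <= MG * fine (mu B) by rewrite !mulr_ge0.
  have h3 : 0 <= MJ * fine (mu A) by rewrite !mulr_ge0.
  have h4 : 0 <= MJ * a1 * b1 by rewrite !mulr_ge0.
  move: (MG * b1 * b1) (MG * fine (mu B)) (MJ * fine (mu A)) (MJ * a1 * b1) hg hj h1 h2 h3 h4.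
  move=> p q r s hg hj p0 q0 r0 s0; nra.
move=> x Bx; rewrite /= -(nonlocalB mB Boo cG GM v v' vL vL' Bx).
rewrite -(nonlocalB mA Aoo cJ JM v v' uL uL' Bx) /coupled_rhs /=; ring.
Qed.

Lemma coupled_rhs_continuous u v :
  @ip_continuous R (E -> R^o) (L2 A) (L2ip A) u ->
  @ip_continuous R (E -> R^o) (L2 B) (L2ip B) v ->
  @ip_continuous R (E -> R^o) (L2 B) (L2ip B) (fun s => coupled_rhs (u s) (v s)).
Proof.
move=> uc vc t t0; have [uL cu] := uc t t0; have [vL cv] := vc t t0.
split=> [|e e0]; first exact: coupled_rhs_L2.
have [C C0 HC] := coupled_rhs_lipschitz.
have e1 : 0 < e / (2 * (C + 1)) by rewrite divr_gt0//; lra.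
have [d1 d10 Hu] := cu _ e1; have [d2 d20 Hv] := cv _ e1.
exists (Num.min d1 d2) => [|s s0]; first by rewrite lt_min d10.
rewrite lt_min => /andP[/(Hu s s0) h1 /(Hv s s0) h2].
apply: (le_lt_trans (HC _ _ _ _ (uc s s0).1 (vc s s0).1 uL vL)).
apply: (@le_lt_trans _ _ (C * (e / (2 * (C + 1)) + e / (2 * (C + 1))))).
  by rewrite ler_wpM2l//; apply: lerD; exact: ltW.
have -> : e / (2 * (C + 1)) + e / (2 * (C + 1)) = e / (C + 1) by field; rewrite gt_eqF//; lra.
by rewrite mulrA ltr_pdivrMr; [nra|lra].
Qed.

(** Testing with [1] says that the total exchange seen from [A] is zero; by evenness of [J], the
    exchange seen from [B] is its opposite. *)
Lemma coupling_mean0 (u v : E -> R) Du : weak_neumann A B J v u Du -> L2 B v ->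
  L2ip B (nonlocal A J u v) (fun=> 1) = 0.
Proof.
move=> [[uL DuL] wn] vL; have mBA := measurableX mB mA.
have [M M0 JM] := kernel_bounded cJ bB bA.
have [M' M'0 JM'] := kernel_bounded cJ bA bB.
have := wn _ _ (H1_cst1 mA Aoo).
rewrite (_ : \int[mu]_(x in A) (\sum_i _) = 0); last first.
  rewrite (_ : (fun x => _) = (fun=> 0)) ?Rintegral_cst ?mul0r//.
  by apply/funext => x; rewrite big1// => i _; rewrite mulr0.
rewrite -[RHS]/(L2ip A (nonlocal B J v u) (fun=> 1)).
rewrite (nonlocal_pairing_swap mA mB Aoo Boo cJ J_even JM' vL uL (L2_cst mA Aoo 1)) => h.
rewrite (nonlocal_pairing mB mA Boo Aoo cJ JM uL vL (L2_cst mB Boo 1)).2.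
rewrite -[RHS]oppr0 h -mulN1r -RintegralZl//.
  by apply: eq_Rintegral => p _; ring.
have := nonlocal_integrable1 mB mA Boo Aoo cJ JM uL vL (L2_cst mB Boo 1).
move=> /(integrableNR mBA); congr (_.-integrable _ (EFin \o _)).
by apply/funext => p; ring.
Qed.

(** Testing with [u] shows that the double integral of [J (v - u) u] is the Dirichlet integral of
    [u]. Since [- J (u - v) v - J (v - u) u = J (u - v)^2], minus the pairing is at least that
    Dirichlet integral, hence nonnegative. *)
Lemma coupling_dissipative (u v : E -> R) Du : weak_neumann A B J v u Du -> L2 B v ->
  L2ip B (nonlocal A J u v) v <= 0.
Proof.
move=> [uH wn] vL; have [uL DuL] := uH; have mBA := measurableX mB mA.
have [M M0 JM] := kernel_bounded cJ bB bA.
have [M' M'0 JM'] := kernel_bounded cJ bA bB.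
have := wn _ _ uH.
rewrite -[RHS]/(L2ip A (nonlocal B J v u) u).
rewrite (nonlocal_pairing_swap mA mB Aoo Boo cJ J_even JM' vL uL uL) => h.
have h0 : 0 <= \int[mu]_(x in A) (\sum_i Du i x * Du i x).
  by apply: Rintegral_ge0 => x _; apply: sumr_ge0 => i _; rewrite -expr2 sqr_ge0.
rewrite h in h0.
rewrite (nonlocal_pairing mB mA Boo Aoo cJ JM uL vL vL).2.
have i1 := nonlocal_integrable1 mB mA Boo Aoo cJ JM uL vL vL.
have i2 : (mu \x mu)%E.-integrable (B `*` A)
    (EFin \o (fun p => J (p.1 - p.2) * (v p.1 - u p.2) * u p.2)).
  have := nonlocal_integrable2 mB mA Boo Aoo cJ JM uL vL uL.
  move=> /(integrableNR mBA); congr (_.-integrable _ (EFin \o _)).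
  by apply/funext => p; ring.
rewrite -oppr_ge0; apply: (le_trans h0).
rewrite -mulN1r -RintegralZl//; apply: le_Rintegral => //.
  exact: integrableZR.
move=> [x y] _ /=; rewrite -subr_ge0.
have -> : -1 * (J (x - y) * (u y - v x) * v x) - J (x - y) * (v x - u y) * u y =
  J (x - y) * (u y - v x) ^+ 2 by ring.
by rewrite mulr_ge0// sqr_ge0.
Qed.

End coupled_dynamics.

Lemma coupling_kernel_even (R : realType) (N : nat) (A B : set 'rV[R]_N) K :
  coupling_kernel A B K -> forall z, K (- z) = K z.
Proof.
move=> HK z; apply: (kernel_radial HK); congr Num.sqrt.
by apply: eq_bigr => i _; rewrite mxE sqrrN.
Qed.

Theorem theorem1p5 (R : realType) (N : nat) (hN : (0 < N)%N)
    (Omega A B : set 'rV[R]_N) (J G : 'rV[R]_N -> R)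
    (Omega_bounded : bounded_set Omega)
    (Omega_domain : domain Omega) (Omega_smooth : smooth_boundary Omega)
    (A_domain : domain A) (A_smooth : smooth_boundary A)
    (B_domain : domain B)
    (AB_disjoint : A `&` B = set0)
    (AB_sub : A `|` B `<=` Omega)
    (interface_null : lebesgue_rV R N (Omega `\` (A `|` B)) = 0%E)
    (J_kernel : coupling_kernel A B J) (G_kernel : coupling_kernel A B G) :
  exists lambda1 : R, 0 < lambda1 /\
    forall (v0 : 'rV[R]_N -> R) (u v : R -> 'rV[R]_N -> R),
      L2 B v0 -> solution A B J G v0 u v ->
      forall t : R, 0 < t ->
        (l2norm B (fun x => v t x - mean B v0)%R <=
         (expR (- lambda1 * t))%:E * l2norm B v0)%E.
Proof.
have [oA _ _] := A_domain; have [oB B0 conB] := B_domain.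
have bsub S : S `<=` Omega -> bounded_set S.
  move=> SO; have [b [br Ob]] := Omega_bounded; exists b; split => // x bx y Sy.
  exact: Ob bx _ (SO _ Sy).
have bA : bounded_set A by apply: bsub => x Ax; apply: AB_sub; left.
have bB : bounded_set B by apply: bsub => x Bx; apply: AB_sub; right.
have [cJ J0 _ _ _ _] := J_kernel; have [cG G_ge0 _ G0 _ _] := G_kernel.
have J_even := coupling_kernel_even J_kernel; have G_even := coupling_kernel_even G_kernel.
have mA := open_measurable_rV oA; have mB := open_measurable_rV oB.
have Boo := lebesgue_rV_bounded mB bB.
have vB0 : 0 < fine (lebesgue_rV R N B) by rewrite fine_gt0// lebesgue_rV_open_gt0.
have [k k0 poincare] := nonlocal_poincare oB B0 conB bB cG G_ge0 G0.
(* [k] is the decay rate of the squared norm, hence the half. *)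
exists (k / 2); split; first by rewrite divr_gt0.
move=> v0 u v v0L [Du [uc vc _ wn vI]] t t0.
have H := L2_semi_inner_product mB.
pose one : 'rV[R]_N -> R^o := fun=> 1.
have oneL : L2 B one by exact: L2_cst.
set m := mean B v0.
have subm (w : 'rV[R]_N -> R) : (fun x => w x - m) = (w : _ -> R^o) - m *: one.
  by apply/funext => x; rewrite [RHS]/GRing.add/= /GRing.opp/= /GRing.scale/= /GRing.scale/= mulr1.
have {}vc := continuous_L2_ip mB vc; have {}uc := continuous_H1_ip mA uc.
have vL s : 0 <= s -> L2 B (v s) by move=> /vc[].
have uL s : 0 <= s -> L2 A (u s) by move=> /uc[].
have Fc := coupled_rhs_continuous oA oB bA bB cJ cG uc vc.
rewrite subm L2_l2norm//; last by apply: (sipB H); [exact: vL (ltW t0)|exact: (sipZ H)].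
rewrite L2_l2norm// -EFinM lee_fin.
have NGL s : 0 <= s -> L2 B (nonlocal B G (v s) (v s)).
  move=> s0; have [M M0 GM] := kernel_bounded cG bB bB.
  by have [] := nonlocal_L2 mB mB Boo Boo cG M0 GM (vL s s0) (vL s s0).
have NJL s : 0 <= s -> L2 B (nonlocal A J (u s) (v s)).
  move=> s0; have [M M0 JM] := kernel_bounded cJ bB bA.
  have Aoo := lebesgue_rV_bounded mA bA.
  by have [] := nonlocal_L2 mB mA Boo Aoo cJ M0 JM (uL s s0) (vL s s0).
have F1 s : 0 <= s -> L2ip B (coupled_rhs A B J G (u s) (v s)) one = 0.
  move=> s0; rewrite [LHS](sip_addl H (NGL s s0) (NJL s s0) oneL).
  by rewrite (nonlocal_mean0 oB bB cG G_even (vL s s0))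
    (coupling_mean0 oA oB bA bB cJ J_even (wn s s0) (vL s s0)) addr0.
apply: (evolution_decay H vc Fc) => //.
- move=> s s0; apply: L2_integral_ip => //; last exact: vI.
  by move=> r r0; apply: coupled_rhs_L2 => //; [exact: uL|exact: vL].
- rewrite (ipBl H v0L (sipZ H m oneL) oneL) (sip_scalel H _ oneL oneL).
  have -> : L2ip B v0 one = \int[lebesgue_rV R N]_(x in B) v0 x.
    by apply: eq_Rintegral => x _; rewrite mulr1.
  by rewrite /L2ip /one /= !mulr1 Rintegral_cst// mul1r /m /mean divfK ?gt_eqF// subrr.
- move=> s s0; have vLs := vL s s0; have zL := sipB H vLs (sipZ H m oneL).
  set z := v s - m *: one in zL *; move=> z1.
  have z0 : \int[lebesgue_rV R N]_(x in B) z x = 0.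
    by rewrite -[RHS]z1; apply: eq_Rintegral => x _; rewrite mulr1.
  have FL := coupled_rhs_L2 oA oB bA bB cJ cG (uL s s0) vLs.
  (* [F] is orthogonal to constants, so [z] may be replaced by [v s] in the pairing, where the
     energy identity and the dissipation apply. *)
  rewrite (ipBr H vLs (sipZ H m oneL) FL) (ipZr H _ oneL FL) F1// mulr0 subr0.
  rewrite [X in 2 * X](sip_addl H (NGL s s0) (NJL s s0) vLs) mulrDr.
  rewrite (nonlocal_energy oB bB cG G_even vLs).
  have dJ := coupling_dissipative oA oB bA bB cJ J_even J0 (wn s s0) vLs.
  (* The energy sees only differences; this returns from [v s] to the mean-zero [z] required by the
     Poincare inequality. *)
  have zE : energy B G z = energy B G (v s).
    apply: eq_Rintegral => -[x y] _ /=; congr (_ * _ ^+ 2).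
    have zx q : z q = v s q - m * 1 by [].
    by rewrite !zx; ring.
  have := poincare z zL z0; rewrite zE => P.
  by rewrite mulNr; lra.
Qed.
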